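(* Suppose that $\mathcal{C}$ is a root class of groups consisting only of periodic groups and $\mathcal{NC}$ is the class of all nilpotent $\mathcal{C}$-groups. Suppose also that $X$ is residually a $\mathcal{C}\mbox{-}\mathcal{BN}_{\mathfrak{P}(\mathcal{C})}$-group, $Y$ is a subgroup of $X$, and there exists a homomorphism $\sigma$ of $X$ onto a $\mathcal{C}\mbox{-}\mathcal{BN}_{\mathfrak{P}(\mathcal{C})}$-group that acts injectively on $Y$. Then the following statements hold. 1. The $\mathfrak{P}(\mathcal{C})'$-isolator $\mathfrak{P}(\mathcal{C})'\mbox{-}\mathfrak{Is}(X, Y)$ is $\mathcal{NC}$-separable in $X$, coincides with the set $\mathfrak{P}(\mathcal{C})'\mbox{-}\mathfrak{Rt}(X, Y)$, and has the same nilpotency class as $Y$. The group $X$ is residually an $\mathcal{NC}$-group and therefore has no $\mathfrak{P}(\mathcal{C})'$-torsion. 2. The homomorphism $\sigma$ acts injectively on the subgroup $\mathfrak{P}(\mathcal{C})'\mbox{-}\mathfrak{Is}(X, Y)$; as a result, the latter belongs to $\mathcal{C}\mbox{-}\mathcal{BN}_{\mathfrak{P}(\mathcal{C})}$.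
   Context: As usual, classes of groups are closed under isomorphism. A class of groups $\mathcal{C}$ is called a root class if it contains at least one non-trivial group and is closed under taking subgroups, extensions, and Cartesian (i.e. unrestricted direct) products of the form $\prod_{y \in Y} X_{y}$, where $X, Y \in \mathcal{C}$ and $X_{y}$ is an isomorphic copy of $X$ for each $y \in Y$. For a class of periodic groups $\mathcal{C}$, $\mathfrak{P}(\mathcal{C})$ denotes the set of all primes each of which divides the order of an element of some $\mathcal{C}$-group. For a set of primes $\mathfrak{P}$, $\mathfrak{P}'$ denotes the set of all primes not in $\mathfrak{P}$; a $\mathfrak{P}$-number is a positive integer all of whose prime divisors lie in $\mathfrak{P}$. A subgroup $Y$ of a group $X$ is $\mathfrak{P}'$-isolated in $X$ if, for any $x \in X$ and $q \in \mathfrak{P}'$, $x^{q} \in Y$ implies $x \in Y$. A group has no $\mathfrak{P}'$-torsion (is $\mathfrak{P}'$-torsion-free) if its trivial subgroup is $\mathfrak{P}'$-isolated. The $\mathfrak{P}'$-isolator $\mathfrak{P}'\mbox{-}\mathfrak{Is}(X, Y)$ is the smallest $\mathfrak{P}'$-isolated subgroup of $X$ containing $Y$; $\mathfrak{P}'\mbox{-}\mathfrak{Rt}(X, Y)$ is the set of all $x \in X$ such that $x^{q} \in Y$ for some $\mathfrak{P}'$-number $q$. For any class of groups $\mathcal{D}$, a subgroup $Y$ of a group $X$ is $\mathcal{D}$-separable in $X$ if for any $x \in X \setminus Y$ there exists a homomorphism $\sigma$ of $X$ onto a group from $\mathcal{D}$ such that $x\sigma \notin Y\sigma$; $X$ is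 residually a $\mathcal{D}$-group if its trivial subgroup is $\mathcal{D}$-separable. For an abelian group $A$ and $p \in \mathfrak{P}(\mathcal{C})$, the subgroup of all elements of $p$-power order of $A$ is called a primary $\mathfrak{P}(\mathcal{C})$-component of $A$. An abelian group $A$ is $\mathcal{C}$-bounded if, for any quotient group $B$ of $A$, each primary $\mathfrak{P}(\mathcal{C})$-component of $B$ has a finite exponent and a cardinality not exceeding the cardinality of some $\mathcal{C}$-group. A nilpotent group is $\mathcal{C}$-bounded if it has at least one finite central series with $\mathcal{C}$-bounded abelian factors. $\mathcal{C}\mbox{-}\mathcal{BN}_{\mathfrak{P}(\mathcal{C})}$ denotes the class of all $\mathfrak{P}(\mathcal{C})'$-torsion-free $\mathcal{C}$-bounded nilpotent groups. A homomorphism acts injectively on a subgroup if its restriction to that subgroup is injective. *)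

(* Defs.v *)
From HB Require Import structures.
From mathcomp Require Import all_boot.
From mathcomp Require Import boolp classical_sets functions cardinality.

Set Implicit Arguments.
Unset Strict Implicit.
Unset Printing Implicit Defensive.

Local Open Scope card_scope.
Local Open Scope classical_set_scope.
Local Open Scope group_scope.

(* Groups are arbitrary (possibly infinite) [groupType]s; a subgroup of [G] is
   a [groupClosed G], that is, a predicate closed under the group operations. *)

Notation hom := UMagmaMorphism.type.

Definition surjective (A B : Type) (f : A -> B) : Prop :=
  forall b, exists a, f a = b.

Definition isomorphic (G H : groupType) : Prop :=
  exists f : hom G H, bijective f.

Definition subgroup_type (G : groupType) (S : groupClosed G) : Type :=
  {x : G | x \in S}.

Section SubgroupType.
Variables (G : groupType) (S : groupClosed G).

HB.instance Definition _ := Choice.on (subgroup_type S).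
HB.instance Definition _ := SubChoice.on (subgroup_type S).

Fact subgroup_closed_subproof : group_closed [pred x in S].
Proof. by split=> [|x y xS yS]; [exact: gpred1 | exact: gpredF]. Qed.

HB.instance Definition _ :=
  SubChoice_isSubGroup.Build G [pred x in S] (subgroup_type S)
    subgroup_closed_subproof.
End SubgroupType.

Section TrivialSubgroup.
Variable G : groupType.

Definition trivial_subgroup : {pred G} := pred1 1.

Fact trivial_mulg_closed : mulg_closed trivial_subgroup.
Proof. by move=> x y /eqP-> /eqP->; rewrite mulg1 inE. Qed.
Fact trivial_group1 : 1 \in trivial_subgroup.
Proof. by rewrite inE. Qed.
Fact trivial_invg_closed : invg_closed trivial_subgroup.
Proof. by move=> x /eqP->; rewrite invg1 inE. Qed.

HB.instance Definition _ := isMulClosed.Build G trivial_subgroup trivial_mulg_closed.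
HB.instance Definition _ := isMul1Closed.Build G trivial_subgroup trivial_group1.
HB.instance Definition _ := isInvClosed.Build G trivial_subgroup trivial_invg_closed.
End TrivialSubgroup.
Arguments trivial_subgroup : clear implicits.

Definition cartesian_product (I : Type) (F : I -> groupType) : Type :=
  forall i, F i.

Section CartesianProduct.
Variables (I : Type) (F : I -> groupType).
Local Notation P := (cartesian_product F).

HB.instance Definition _ := Choice.copy P (forall i, F i : choiceType).

Let mulP (f g : P) : P := fun i => f i * g i.
Let oneP : P := fun i => 1.
Let invP (f : P) : P := fun i => (f i)^-1.

Let mulPA : associative mulP.
Proof. by move=> f g h; apply: functional_extensionality_dep => i; exact: mulgA. Qed.
Let mul1P : left_id oneP mulP.
Proof. by move=> f; apply: functional_extensionality_dep => i; exact: mul1g. Qed.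
Let mulP1 : right_id oneP mulP.
Proof. by move=> f; apply: functional_extensionality_dep => i; exact: mulg1. Qed.
Let mulVP : left_inverse oneP invP mulP.
Proof. by move=> f; apply: functional_extensionality_dep => i; exact: mulVg. Qed.
Let mulPV : right_inverse oneP invP mulP.
Proof. by move=> f; apply: functional_extensionality_dep => i; exact: mulgV. Qed.

HB.instance Definition _ := isGroup.Build P mulPA mul1P mulP1 mulVP mulPV.
End CartesianProduct.

Definition normal (G : groupType) (N : {pred G}) : Prop :=
  forall x g : G, x \in N -> x ^ g \in N.

(* [Q] is (isomorphic to) [G / N]; the condition on [f] makes [N] its kernel,
   hence a normal subgroup. *)
Definition is_quotient (G : groupType) (N : {pred G}) (Q : groupType) : Prop :=
  exists f : hom G Q, surjective f /\ forall x, f x = 1 <-> x \in N.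

(* [Q] is (isomorphic to) [H / K], where [K] is contained in [H]. *)
Definition is_factor (G : groupType) (K H : groupClosed G) (Q : groupType)
    : Prop :=
  is_quotient [pred x : subgroup_type H | val x \in K] Q.

Definition group_class := groupType -> Prop.

Definition iso_closed (C : group_class) : Prop :=
  forall G H : groupType, isomorphic G H -> C G -> C H.

Definition subgroup_closed (C : group_class) : Prop :=
  forall (G : groupType) (H : groupClosed G), C G -> C (subgroup_type H).

Definition extension_closed (C : group_class) : Prop :=
  forall (G : groupType) (N : groupClosed G) (Q : groupType),
    is_quotient N Q -> C (subgroup_type N) -> C Q -> C G.

Definition product_closed (C : group_class) : Prop :=
  forall (X Y : groupType) (F : Y -> groupType),
    C X -> C Y -> (forall y, isomorphic X (F y)) -> C (cartesian_product F).

Record root_class (C : group_class) : Prop := {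
  root_iso : iso_closed C;
  root_nontrivial : exists G : groupType, C G /\ exists x : G, x <> 1;
  root_subgroup : subgroup_closed C;
  root_extension : extension_closed C;
  root_product : product_closed C
}.

Definition periodic (G : groupType) : Prop :=
  forall x : G, exists n : nat, (0 < n)%N /\ x ^+ n = 1.

Definition has_order (G : groupType) (x : G) (n : nat) : Prop :=
  [/\ (0 < n)%N, x ^+ n = 1 & forall m, (0 < m)%N -> x ^+ m = 1 -> (n <= m)%N].

Definition primes_of (C : group_class) : nat_pred :=
  [pred p | `[< prime p /\
     exists (G : groupType) (x : G) (n : nat),
       [/\ C G, has_order x n & (p %| n)%N] >]].

(* [pi] stands for a set of primes; the test [prime q] is needed because the
   library complement [pi^'] also contains all the non-primes. *)
Definition isolated (pi : nat_pred) (G : groupType) (Y : {pred G}) : Prop :=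
  forall (x : G) (q : nat), prime q -> q \in pi -> x ^+ q \in Y -> x \in Y.

Definition torsion_free (pi : nat_pred) (G : groupType) : Prop :=
  isolated pi (trivial_subgroup G).

Definition isolator (pi : nat_pred) (G : groupType) (Y : {pred G}) : {pred G} :=
  [pred x | `[< forall H : groupClosed G,
     isolated pi H -> {subset Y <= H} -> x \in H >]].

Section IsolatorSubgroup.
Variables (pi : nat_pred) (G : groupType) (Y : {pred G}).
Local Notation I := (isolator pi Y).

Fact isolator_mulg_closed : mulg_closed I.
Proof.
move=> x y /asboolP xI /asboolP yI; apply/asboolP => H iH sH.
by apply: gpredM; [exact: xI | exact: yI].
Qed.
Fact isolator_group1 : 1 \in I.
Proof. by apply/asboolP => H _ _; exact: gpred1. Qed.
Fact isolator_invg_closed : invg_closed I.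
Proof.
by move=> x /asboolP xI; apply/asboolP => H iH sH; apply: gpredVr; exact: xI.
Qed.

HB.instance Definition _ := isMulClosed.Build G I isolator_mulg_closed.
HB.instance Definition _ := isMul1Closed.Build G I isolator_group1.
HB.instance Definition _ := isInvClosed.Build G I isolator_invg_closed.
End IsolatorSubgroup.

Lemma isolator_isolated (pi : nat_pred) (G : groupType) (Y : {pred G}) :
  isolated pi (isolator pi Y).
Proof.
move=> x q q_pr qpi /asboolP xqI; apply/asboolP => H iH sH.
exact: (iH x q q_pr qpi (xqI H iH sH)).
Qed.

Lemma sub_isolator (pi : nat_pred) (G : groupType) (Y : {pred G}) :
  {subset Y <= isolator pi Y}.
Proof. by move=> x xY; apply/asboolP => H _ sH; exact: sH. Qed.

Lemma isolator_min (pi : nat_pred) (G : groupType) (Y : {pred G})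
    (H : groupClosed G) :
  isolated pi H -> {subset Y <= H} -> {subset isolator pi Y <= H}.
Proof. by move=> iH sH x /asboolP/(_ H iH sH). Qed.

Definition root_set (pi : nat_pred) (G : groupType) (Y : {pred G}) : {pred G} :=
  [pred x | `[< exists q : nat, pi.-nat q /\ x ^+ q \in Y >]].

Definition separable (D : group_class) (G : groupType) (Y : {pred G}) : Prop :=
  forall x : G, x \notin Y ->
    exists (Q : groupType) (f : hom G Q),
      [/\ D Q, surjective f & ~ (f @` [set y | y \in Y]) (f x)].

Definition residually (D : group_class) (G : groupType) : Prop :=
  separable D (trivial_subgroup G).

Definition central_series (G : groupType) (n : nat) (H : nat -> groupClosed G)
    : Prop :=
  [/\ H 0 =i trivial_subgroup G,
      H n =i predT,
      forall i, (i <= n)%N -> normal (H i),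
      forall i, (i < n)%N -> {subset H i <= H i.+1} &
      (* [H i.+1 / H i] lies in the center of [G / H i] *)
      forall i, (i < n)%N -> forall x g : G, x \in H i.+1 -> [~ x, g] \in H i].

Definition nilpotent (G : groupType) : Prop :=
  exists (n : nat) (H : nat -> groupClosed G), central_series n H.

Definition nilpotency_class (G : groupType) (c : nat) : Prop :=
  (exists H : nat -> groupClosed G, central_series c H) /\
  forall (m : nat) (H : nat -> groupClosed G), central_series m H -> (c <= m)%N.

Definition nilpotent_class (C : group_class) : group_class :=
  fun G => nilpotent G /\ C G.

Definition abelian (G : groupType) : Prop := forall x y : G, commute x y.

Definition primary_component (p : nat) (B : groupType) : set B :=
  [set b | exists k : nat, b ^+ (p ^ k) = 1].

Definition bounded_abelian (C : group_class) (A : groupType) : Prop :=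
  abelian A /\
  forall (N : groupClosed A) (B : groupType), is_quotient N B ->
    forall p : nat, p \in primes_of C ->
      (exists n : nat, (0 < n)%N /\
         forall b : B, primary_component p b -> b ^+ n = 1) /\
      (exists G : groupType, C G /\ @primary_component p B #<= [set: G]).

Definition bounded_nilpotent (C : group_class) (G : groupType) : Prop :=
  exists (n : nat) (H : nat -> groupClosed G),
    central_series n H /\
    forall i, (i < n)%N ->
      exists Q : groupType, is_factor (H i) (H i.+1) Q /\ bounded_abelian C Q.

(* The class C-BN_{P(C)} of P(C)'-torsion-free C-bounded nilpotent groups. *)
Definition BN (C : group_class) : group_class :=
  fun G => torsion_free (primes_of C)^' G /\ bounded_nilpotent C G.

(* Main.v *)
From HB Require Import structures.
Require Import Defs.
From mathcomp Require Import all_boot.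
From mathcomp Require Import boolp classical_sets functions cardinality.

Set Implicit Arguments.
Unset Strict Implicit.
Unset Printing Implicit Defensive.

Local Open Scope classical_set_scope.
Local Open Scope group_scope.

(** Let P be the set of primes of C and pi its complement among the primes; a
pi-root of Y is an element with a pi-power in Y.

Roots. In a nilpotent group the pi-roots of a subgroup form a subgroup
([subgrp_roots]), and if there is no pi-torsion then pi-roots are unique
([root_unique]). Both are proved by induction on the class, replacing the
group K by a normal subgroup of smaller class that contains a given element
([cseries_shorter]). Uniqueness of roots yields more: two elements commute as
soon as some of their pi-powers do, so a nilpotent group without pi-torsion
has the same class as each subgroup containing a pi-power of every element
([cseries_dense]).

Separability. Let G be C-bounded nilpotent, Y a pi-isolated subgroup and x an
element outside Y ([bounded_separable]). Climbing a central series H from Y,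
one reduces to an element h that is central modulo some D = H i and lies
outside an isolated subgroup J containing Y and D. There is a prime p in P
such that h is not in J D <h^p>. A normal subgroup N that contains D and h^p,
and is maximal such that h is not in J N, gives a quotient G / N in which
every nontrivial central subgroup contains the image of h
([monolithic_quotient]). Hence the centre of G / N is a p-group; boundedness
gives it a finite exponent, so G / N has finite p-power exponent
([nilpotent_exponent]). The factors of a bounded central series of G / N are
then abelian p-groups of finite exponent, no larger than some C-group; such
groups embed, one layer of exponent p at a time, in Cartesian powers of a
C-group indexed by a C-group, hence belong to C
([finite_exponent_in_root]). As C is closed under extensions, G / N is a
C-group.

The group X. It need not be nilpotent, but the pair (sigma, f) maps it to the
bounded nilpotent group Q * B for each homomorphism f to a member B of the
class BN. As sigma is injective on Y, an equality sigma (x ^+ n) = sigma z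
with z in Y forces f (x ^+ n) = f z whenever (sigma x, f x) is a pi-root of
the image of Y ([pair_root]). Since these f separate the points of X, the
pi-roots of Y form a subgroup, which is the isolator, and sigma is injective
on it; the same remark finds, for x outside the isolator, a homomorphism to
which [bounded_separable] applies. *)

(** Both sides of an identity valid in every group have the same reduced
word. *)
Ltac group_identity :=
  rewrite /commg /conjg;
  rewrite ?(invgM, invgK, mulgA, mulgK, mulgVK, mulVg, mulgV, mul1g, mulg1,
            invg1).

(** * Subgroups as sets *)

(** Subgroups given by arbitrary sets rather than by [groupClosed] structures,
so that sets built in the course of a proof can be used at once. *)
Definition subgrp (G : groupType) (A : set G) : Prop :=
  A 1 /\ forall x y, A x -> A y -> A (x / y).

Section Subgrp.
Variables (G : groupType).
Implicit Types (A B S R : set G) (x y g : G).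

Lemma sgV A x : subgrp A -> A x -> A x^-1.
Proof. by case=> A1 AF /(AF _ _ A1); rewrite div1g. Qed.

Lemma sgM A x y : subgrp A -> A x -> A y -> A (x * y).
Proof. by move=> sA Ax /(sgV sA)/(sA.2 _ _ Ax); rewrite invgK. Qed.

Lemma sgX A x n : subgrp A -> A x -> A (x ^+ n).
Proof.
move=> sA Ax; elim: n => [|n IHn]; first by rewrite expg0; case: sA.
by rewrite expgS; apply: sgM.
Qed.

Lemma sgJ A x y : subgrp A -> A x -> A y -> A (x ^ y).
Proof.
by move=> sA Ax Ay; rewrite conjgE; do !apply: sgM => //; apply: sgV.
Qed.

Lemma sgR A x y : subgrp A -> A x -> A y -> A [~ x, y].
Proof.
move=> sA Ax Ay; rewrite commgEl; apply: sgM (sgJ _ _ _) => //.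
exact: sgV.
Qed.

Lemma subgrpI A B : subgrp A -> subgrp B -> subgrp (A `&` B).
Proof.
move=> sA sB; split=> [|x y [Ax Bx] [Ay By]].
  by split; [case: sA | case: sB].
by split; [apply: sA.2 | apply: sB.2].
Qed.

Lemma subgrpT : subgrp [set: G]. Proof. by []. Qed.

Lemma subgrp1 : subgrp [set 1 : G].
Proof. by split=> // x y -> ->; rewrite mulgV. Qed.

Lemma subgrp_carrier (H : groupClosed G) : subgrp [set x | x \in H].
Proof. by split=> [|x y]; [exact: gpred1 | exact: gpredF]. Qed.

Definition setmul A B : set G :=
  [set z | exists x y, [/\ A x, B y & z = x * y]].

Lemma subgrp_setmul S R : subgrp S -> subgrp R ->
  (forall s r, S s -> R r -> R (r ^ s)) -> subgrp (setmul S R).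
Proof.
move=> sS sR SR; split=> [|_ _ [s [r [Ss Rr ->]]] [s' [r' [Ss' Rr' ->]]]].
  by exists 1, 1; rewrite mulg1; split=> //; [case: sS | case: sR].
exists (s / s'), ((r / r') ^ s'^-1).
by split; [apply: sS.2 | apply/SR/sR.2 => //; apply: sgV | group_identity].
Qed.

Lemma setmull S R : R 1 -> S `<=` setmul S R.
Proof. by move=> R1 s Ss; exists s, 1; rewrite mulg1. Qed.

Lemma setmulr S R : S 1 -> R `<=` setmul S R.
Proof. by move=> S1 r Rr; exists 1, r; rewrite mul1g. Qed.

(** The cyclic subgroup generated by [x]: a quotient of two natural powers
stands for an integer power. *)
Definition cyc x : set G := [set y | exists k l, y = x ^+ k / x ^+ l].

Lemma subgrp_cyc x : subgrp (cyc x).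
Proof.
split=> [|_ _ [k [l ->]] [k' [l' ->]]]; first by exists 0, 0; rewrite mulgV.
exists (k + l')%N, (l + k')%N; rewrite invgF !expgnDr invgM -!mulgA.
have /commute_sym cl: commute (x ^+ l' / x ^+ k') (x ^- l).
  apply/commuteV/commute_sym/commuteM; first exact: commuteX2.
  by apply/commuteV/commuteX2.
by congr (_ * _); rewrite cl mulgA.
Qed.

Lemma cyc_id x : cyc x x.
Proof. by exists 1%N, 0; rewrite expg1 expg0 invg1 mulg1. Qed.
End Subgrp.

(** * Central series of a subgroup *)

Section Cseries.
Variable G : groupType.
Implicit Types (K S R : set G) (H : nat -> set G) (x y g : G).

(** A central series of the subgroup [K] of [G] whose terms are cut out of [K]
by subgroups [H i] of [G] that need not lie in [K]: shrinking [K] keeps [H],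
and terms that are irrelevant to [K] may be replaced by the whole group. *)
Definition cseries K n H : Prop :=
  [/\ forall i, subgrp (H i), H 0 `<=` [set 1], K `<=` H n,
      forall i, H i `<=` H i.+1 &
      forall i x g, K x -> K g -> H i.+1 x -> H i [~ x, g] ].

Lemma cseries_normal K n H i x g :
  cseries K n H -> K x -> K g -> H i x -> H i (x ^ g).
Proof.
move=> [sH H0 Hn Hi HR] Kx Kg Hx.
case: i Hx => [/H0->|i Hx]; first by rewrite conj1g; case: (sH 0).
rewrite -[x ^ g](mulKg x^-1) invgK -commgEl; apply: sgM => //.
by apply/Hi/HR.
Qed.

(** The induction on the class. Modulo [H n], the term [H n.+1] is central in
[K]; hence it lies, together with [x], in the centre [K'] of the centralizer
of [x]. Being abelian modulo [H n], [K'] has a shorter series, and it is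
normal in [K] because it contains [H n.+1], hence all commutators of [K]. *)
Lemma cseries_shorter K n H x : subgrp K -> cseries K n.+2 H -> K x ->
  exists K' H', [/\ subgrp K', K' `<=` K, K' x,
    forall y g, K' y -> K g -> K' (y ^ g) & cseries K' n.+1 H'].
Proof.
move=> sK csK Kx; have [sH H0 Hn Hi HR] := csK.
pose C (Z : set G) := [set y | K y /\ forall z, Z z -> H n [~ z, y]].
have sC (Z : set G): Z `<=` K -> subgrp (C Z).
  move=> sZ; split=> [|y y' [Ky Zy] [Ky' Zy']].
    by split=> [|z _]; [case: sK | rewrite commg1; case: (sH n)].
  split=> [|z Zz]; first exact: sK.2.
  have -> : [~ z, y / y'] = ([~ z, y'] ^-1 * [~ z, y]) ^ y'^-1.
    by group_identity.
  have Kz := sZ _ Zz.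
  apply: (cseries_normal csK); [|exact: sgV|].
    by apply: sgM => //; [apply: sgV => //|]; apply: sgR.
  by apply: sgM => //; [apply: sgV => //; apply: Zy'|apply: Zy].
have CK Z : C Z `<=` K by move=> y [].
have s1 : [set x] `<=` K by move=> _ ->.
pose C1 := C [set x]; pose K' := C1 `&` C C1.
have sK' : subgrp K' by apply: subgrpI; apply: sC => //; apply: CK.
have K'K : K' `<=` K by move=> y [/CK].
have HK' y : K y -> H n.+1 y -> K' y.
  move=> Ky Hy; have Hzy z : K z -> H n [~ z, y].
    by move=> Kz; rewrite -invgR; apply: sgV => //; apply: HR.
  by split; split=> // z; [move=> -> | case=> Kz _]; apply: Hzy.
exists K', (fun i => if (i <= n)%N then H i else setT); split=> //.
- split; first by split=> // _ ->; rewrite commgg; case: (sH n).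
  split=> // z [Kz /(_ _ erefl)]; rewrite -invgR => Hxz.
  by rewrite -[[~ _, _]]invgK; apply: sgV.
- move=> y g K'y Kg; rewrite -[y ^ g](mulKg y^-1) invgK -commgEl.
  have Ky := K'K _ K'y.
  apply: sgM => //; apply: HK'; first exact: sgR.
  by apply: HR => //; apply: Hn.
split=> //.
- by move=> i; case: ifP.
- by rewrite ltnn.
- move=> i /=; case: (ltnP i n) => [/ltnW->|_ y //]; exact: Hi.
move=> i y g K'y K'g; case: (ltngtP i n) => [ltin|//|->].
  by apply: HR; exact: K'K.
by move=> _; case: K'y K'g => C1y _ [_ [_]]; apply.
Qed.

Lemma cseries_abelian K n H x y :
  cseries K n H -> (n <= 1)%N -> K x -> K y -> commute x y.
Proof.
move=> [sH H0 Hn Hi HR] n1 Kx Ky; apply/commgP/eqP/H0/HR => //.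
by case: n n1 Hn => [|[|//]] _ /(_ _ Kx) // /Hi.
Qed.

(** * Roots in nilpotent groups *)

Definition roots (pi : nat_pred) K S : set G :=
  [set x | K x /\ exists q, pi.-nat q /\ S (x ^+ q)].

Lemma sub_roots pi K S : S `<=` K -> S `<=` roots pi K S.
Proof. by move=> sSK x Sx; split; [apply: sSK | exists 1%N]. Qed.

Lemma rootsK pi K S : roots pi K (roots pi K S) `<=` roots pi K S.
Proof.
move=> x [Kx [q [piq [_ [r [pir]]]]]] Sx; split=> //; exists (q * r)%N.
by rewrite pnatM piq expgnA.
Qed.

(** The subgroups [S (R :&: H i)] form a series from [S] to [S R] in which each
term is normal in the next one, and each quotient is abelian and consists of
images of pi-roots of [S]. *)
Lemma sub_setmul_roots pi K n H S R :
  subgrp K -> cseries K n H -> subgrp S -> subgrp R -> S `<=` K ->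
  R `<=` roots pi K S -> (forall s r, S s -> R r -> R (r ^ s)) ->
  setmul S R `<=` roots pi K S.
Proof.
move=> sK csK sS sR SK Rrt SR; have [sH H0 Hn Hi HR] := csK.
have RK : R `<=` K by move=> r /Rrt[].
suff claim i s r : S s -> R r -> H i r ->
    exists q, pi.-nat q /\ S ((s * r) ^+ q).
  move=> _ [s [r [Ss Rr ->]]]; split.
    by apply: sgM; [|exact: SK|exact: RK].
  by apply: (claim n) => //; apply/Hn/RK.
elim: i s r => [|i IHi] s r Ss Rr Hr.
  by exists 1%N; rewrite expg1 (H0 _ Hr) mulg1.
pose M := setmul S (R `&` H i).
have sM : subgrp M.
  apply: subgrp_setmul => // [|s' r' Ss' [Rr' Hr']]; first exact: subgrpI.
  split; first exact: SR.
  by apply: (cseries_normal csK) => //; [apply: RK | apply: SK].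
have SM : S `<=` M by apply: setmull; split; [case: sR | case: (sH i)].
have Ms k : M (s ^ (r ^- k)).
  have Rk : R (r ^- k) by apply: sgV => //; apply: sgX.
  rewrite -[s ^ _](mulKg s^-1) invgK -commgEl; exists s, [~ s, r ^- k].
  split=> //; split.
    rewrite -invgR commgEl; apply: sgV => //; apply: sgM => //.
      exact: sgV.
    exact: SR.
  rewrite -invgR; apply: sgV => //; apply: HR; [exact: RK|exact: SK|].
  by apply: sgV => //; apply: sgX.
(* As [r] normalizes [M] and [s] lies in [M], the powers of [s * r] and of [r]
   agree modulo [M]. *)
have Msr k : exists m, M m /\ (s * r) ^+ k = m * r ^+ k.
  elim: k => [|k [m [Mm IHk]]]; first by exists 1; rewrite mulg1; case: sM.
  exists (m * s ^ (r ^- k)); split; first exact: sgM.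
  by rewrite expgSr IHk expgSr; group_identity.
have [_ [q [piq Srq]]] := Rrt _ Rr.
have [m [Mm Em]] := Msr q.
have [s' [r' [Ss' [Rr' Hr'] Em']]] : M ((s * r) ^+ q).
  by rewrite Em; apply: sgM => //; apply: SM.
have [q' [piq' Sq']] := IHi _ _ Ss' Rr' Hr'.
by exists (q * q')%N; rewrite pnatM piq piq' expgnA Em'.
Qed.

(** If [x] is a pi-root of [S], then in the smaller group [K'] containing [x]
the roots [R] of [S :&: K'] form, by induction, a subgroup, normalized by [S];
so [x] can be adjoined to [S] inside the set of roots of [S]. Adjoining two
roots in succession gives a subgroup of roots that contains both. *)
Lemma subgrp_roots pi n K H S :
  subgrp K -> cseries K n H -> subgrp S -> S `<=` K -> subgrp (roots pi K S).
Proof.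
elim: n K H S => [|[|n] IHn] K H S sK csK sS SK.
1,2: split=> [|x y [Kx [q [piq Sq]]] [Ky [r [pir Sr]]]];
  first by apply: sub_roots => //; case: sS.
1,2: split; first exact: sK.2.
1,2: exists (q * r)%N; split; first by rewrite pnatM piq.
1,2: rewrite expgnFl; last exact: (cseries_abelian csK).
1,2: by apply: sS.2; [rewrite expgnA | rewrite mulnC expgnA]; apply: sgX.
have adj S0 x : subgrp S0 -> S0 `<=` K -> roots pi K S0 x ->
    exists S', [/\ subgrp S', S0 `<=` S', S' x & S' `<=` roots pi K S0].
  move=> sS0 S0K [Kx [q [piq Sq]]].
  have [K' [H' [sK' K'K K'x K'J csK']]] := cseries_shorter sK csK Kx.
  pose R := roots pi K' (S0 `&` K').
  have sR : subgrp R by apply: IHn csK' _ _ => //; exact: subgrpI.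
  have S0R s r : S0 s -> R r -> R (r ^ s).
    move=> Ss [K'r [t [pit [Sr K'rt]]]]; split.
      by apply: K'J => //; exact: S0K.
    exists t; split=> //; rewrite -conjXg; split; first exact: sgJ.
    by apply: K'J => //; apply: S0K.
  have Rx : R x by split=> //; exists q; split=> //; split=> //; exact: sgX.
  exists (setmul S0 R); split.
  - exact: subgrp_setmul.
  - by apply: setmull; case: sR.
  - by apply: setmulr => //; case: sS0.
  apply: (sub_setmul_roots sK csK) => // r [/K'K Kr [t [pit [Sr _]]]].
  by split=> //; exists t.
split=> [|x y rx ry]; first by apply: sub_roots => //; case: sS.
have [S1 [sS1 SS1 S1x S1rt]] := adj _ _ sS SK rx.
have S1K : S1 `<=` K by move=> z /S1rt[].
have ry1 : roots pi K S1 y.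
  by case: ry => Ky [q [piq /SS1]]; split=> //; exists q.
have [S2 [sS2 SS2 S2y S2rt]] := adj _ _ sS1 S1K ry1.
apply: rootsK; have [Kxy [q [piq /S1rt Sq]]] : roots pi K S1 (x / y).
  by apply: S2rt; apply: sS2.2 => //; apply: SS2.
by split=> //; exists q.
Qed.

(** If [x] and [y] commute then [x / y] is a torsion element. Otherwise compare
[x ^ y] with [x]: they lie in a smaller group and have the same power of
exponent [q], namely [y ^+ q], so they are equal by induction. *)
Lemma root_unique (pi : nat_pred) n K H : subgrp K -> cseries K n H ->
  (forall x q, K x -> pi.-nat q -> x ^+ q = 1 -> x = 1) ->
  forall x y q, K x -> K y -> pi.-nat q -> x ^+ q = y ^+ q -> x = y.
Proof.
have com K0 : (forall x q, K0 x -> pi.-nat q -> x ^+ q = 1 -> x = 1) ->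
    subgrp K0 -> forall x y q, K0 x -> K0 y -> pi.-nat q ->
    x ^+ q = y ^+ q -> commute x y -> x = y.
  move=> tf sK x y q Kx Ky piq eq cxy; apply/divg1_eq/(tf _ q) => //.
    exact: sK.2.
  by rewrite expgnFl // eq mulgV.
elim: n K H => [|[|n] IHn] K H sK csK tf x y q Kx Ky piq eq.
1,2: by apply: (com K tf sK x y q Kx Ky piq eq); exact: (cseries_abelian csK).
apply: (com K tf sK x y q Kx Ky piq eq); apply/commgP/conjg_fixP.
have [K' [H' [sK' K'K K'x K'J csK']]] := cseries_shorter sK csK Kx.
apply: (IHn K' H' sK' csK' _ _ _ q _ K'x piq) => [z r /K'K||].
- exact: tf.
- exact: K'J.
rewrite -conjXg eq; apply/conjg_fixP/commgP/commute_sym/commuteX.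
exact: commute_refl.
Qed.

End Cseries.

(** * Homomorphisms and quotient groups *)

Section HomOfMorph.
Variables (G H : groupType) (f : G -> H).

Definition morph_fun of {morph f : x y / x * y} := f.

Hypothesis fM : {morph f : x y / x * y}.

Fact morph_fun1 : morph_fun fM 1 = 1.
Proof. by apply: (mulgI (f 1)); rewrite /morph_fun -fM !mulg1. Qed.

HB.instance Definition _ := isMultiplicative.Build G H (morph_fun fM) fM.
HB.instance Definition _ :=
  Multiplicative_isUMagmaMorphism.Build G H (morph_fun fM) morph_fun1.

Definition mkhom : hom G H := morph_fun fM.
End HomOfMorph.

Section GroupOfSet.
Variables (G : groupType) (A : set G).

Definition gset of subgrp A : {pred G} := [pred x | `[< A x >]].

Hypothesis sA : subgrp A.
Local Notation S := (gset sA).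

Fact gset_mulg_closed : mulg_closed S.
Proof. by move=> x y /asboolP Ax /asboolP Ay; apply/asboolP; exact: sgM. Qed.
Fact gset_group1 : 1 \in S.
Proof. by apply/asboolP; case: sA. Qed.
Fact gset_invg_closed : invg_closed S.
Proof. by move=> x /asboolP Ax; apply/asboolP; exact: sgV. Qed.

HB.instance Definition _ := isMulClosed.Build G S gset_mulg_closed.
HB.instance Definition _ := isMul1Closed.Build G S gset_group1.
HB.instance Definition _ := isInvClosed.Build G S gset_invg_closed.

Definition grp : groupClosed G := S.

Lemma grpE x : x \in grp <-> A x.
Proof. by split=> [/asboolP //|Ax]; apply/asboolP. Qed.
End GroupOfSet.

Definition normalized (G : groupType) (A : set G) : Prop :=
  forall x g, A x -> A (x ^ g).

Section Quotient.
Local Open Scope quotient_scope.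
Variables (G : groupType) (A : set G) (sA : subgrp A).

Definition coset_rel : rel G := fun x y => `[< A (x^-1 * y) >].

Fact coset_refl : reflexive coset_rel.
Proof. by move=> x; apply/asboolP; rewrite mulVg; case: sA. Qed.
Fact coset_sym : symmetric coset_rel.
Proof.
suff sym x y : coset_rel x y -> coset_rel y x.
  by move=> x y; apply/idP/idP; apply: sym.
by move=> /asboolP Axy; apply/asboolP; rewrite -(invgK x) -invgM; apply: sgV.
Qed.
Fact coset_trans : transitive coset_rel.
Proof.
move=> y x z /asboolP Axy /asboolP Ayz; apply/asboolP.
by rewrite -(mulgK y x^-1) -mulgA; apply: sgM.
Qed.

Canonical coset_equiv := EquivRel coset_rel coset_refl coset_sym coset_trans.

Definition quotient of normalized A := {eq_quot coset_equiv}.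

Hypothesis nA : normalized A.
Local Notation Q := (quotient nA).
HB.instance Definition _ := Choice.on Q.
HB.instance Definition _ : EqQuotient G coset_rel Q := EqQuotient.on Q.

Let mulQ (u v : Q) : Q := \pi_Q (repr u * repr v).
Let invQ (u : Q) : Q := \pi_Q ((repr u)^-1).
Let oneQ : Q := \pi_Q 1.

Fact piQE x y : \pi_Q x = \pi_Q y <-> A (x^-1 * y).
Proof.
by split=> [/(@eqquotP _ _ Q)/asboolP //|Axy]; apply/(@eqquotP _ _ Q)/asboolP.
Qed.

Let piM x y : mulQ (\pi_Q x) (\pi_Q y) = \pi_Q (x * y).
Proof.
apply/piQE; rewrite invgM.
set x' := repr (\pi_Q x); set y' := repr (\pi_Q y).
have Ax : A (x'^-1 * x) by apply/piQE; exact: reprK.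
have Ay : A (y'^-1 * y) by apply/piQE; exact: reprK.
have -> : y'^-1 * x'^-1 * (x * y) = (x'^-1 * x) ^ y' * (y'^-1 * y).
  by group_identity.
by apply: sgM => //; apply: nA.
Qed.

Let piV x : invQ (\pi_Q x) = \pi_Q (x^-1).
Proof.
apply/piQE; set x' := repr _; rewrite invgK.
have Ax : A (x'^-1 * x) by apply/piQE; exact: reprK.
have -> : x' / x = (x'^-1 * x)^-1 ^ x'^-1 by group_identity.
by apply: nA; apply: sgV.
Qed.

Let piS u : exists x, u = \pi_Q x.
Proof. by exists (repr u); rewrite reprK. Qed.

Let mulQA : associative mulQ.
Proof.
move=> u v w; have [x ->] := piS u; have [y ->] := piS v; have [z ->] := piS w.
by rewrite (piM y) (piM x) (piM x) (piM (x * y)) mulgA.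
Qed.
Let mul1Q : left_id oneQ mulQ.
Proof. by move=> u; have [x ->] := piS u; rewrite (piM 1) mul1g. Qed.
Let mulQ1 : right_id oneQ mulQ.
Proof. by move=> u; have [x ->] := piS u; rewrite (piM x) mulg1. Qed.
Let mulVQ : left_inverse oneQ invQ mulQ.
Proof. by move=> u; have [x ->] := piS u; rewrite (piV x) (piM x^-1) mulVg. Qed.
Let mulQV : right_inverse oneQ invQ mulQ.
Proof. by move=> u; have [x ->] := piS u; rewrite (piV x) (piM x) mulgV. Qed.

HB.instance Definition _ := isGroup.Build Q mulQA mul1Q mulQ1 mulVQ mulQV.

Lemma quotient_exists :
  exists (R : groupType) (f : hom G R),
    surjective f /\ forall x, f x = 1 <-> A x.
Proof.
exists Q, (@mkhom G Q (fun x => \pi_Q x) (fun x y => esym (piM x y))).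
split=> [u|x]; first by exists (repr u); exact: reprK.
rewrite /= -[1]/(\pi_Q 1) piQE mulg1.
by split=> [/(sgV sA)|/(sgV sA)//]; rewrite invgK.
Qed.
End Quotient.

Section Homs.
Implicit Types (G H K : groupType).

Lemma hom_eq G H (f : hom G H) x y : f x = f y <-> f (x / y) = 1.
Proof.
rewrite gmulfF; split=> [->|]; first by rewrite mulgV.
exact: divg1_eq.
Qed.

(** The homomorphism theorem, for a quotient of [G] given by any surjective
[f]. *)
Lemma hom_factor G H K (f : hom G H) (k : hom G K) :
  surjective f -> (forall x, f x = 1 -> k x = 1) ->
  exists l : hom H K, forall x, l (f x) = k x.
Proof.
move=> fS fk; pose r y := sval (cid (fS y)).
have fr y : f (r y) = y by rewrite /r; case: cid.
have krf x : k (r (f x)) = k x by apply/hom_eq/fk/hom_eq/fr.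
have lM : {morph (fun y => k (r y)) : x y / x * y}.
  move=> x y; rewrite -[in LHS](fr x) -[in LHS](fr y) -gmulfM krf gmulfM //.
by exists (mkhom lM) => x; apply: krf.
Qed.

Lemma subgrp_preim G H (f : hom G H) (B : set H) :
  subgrp B -> subgrp (f @^-1` B).
Proof.
move=> sB; split=> [|x y Bx By]; rewrite /preimage /= ?gmulf1.
  by case: sB.
by rewrite gmulfF; apply: sB.2.
Qed.

Lemma subgrp_image G H (f : hom G H) (A : set G) :
  subgrp A -> subgrp (f @` A).
Proof.
move=> sA; split=> [|_ _ [x Ax <-] [y Ay <-]].
  by exists 1; rewrite ?gmulf1 //; case: sA.
by exists (x / y); [apply: sA.2 | rewrite gmulfF].
Qed.

Lemma normalized_preim G H (f : hom G H) (B : set H) :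
  normalized B -> normalized (f @^-1` B).
Proof. by move=> nB x g Bx; rewrite /preimage /= gmulfJ; apply: nB. Qed.

Lemma corestrict G H (f : hom G H) (B : groupClosed H) :
  (forall x, f x \in B) ->
  exists g : hom G (subgroup_type B), forall x, val (g x) = f x.
Proof.
move=> fB; pose g x : subgroup_type B := Sub (f x) (fB x).
have gM : {morph g : x y / x * y}.
  by move=> x y; apply: val_inj; rewrite /= gmulfM.
by exists (mkhom gM).
Qed.
End Homs.

(** * Bounded nilpotent groups *)

Section Bounded.
Variable C : group_class.
Implicit Types (G A B D Q : groupType).

Definition hcomp G A B (g : hom A B) (f : hom G A) : hom G B := g \o f.
Definition incl G (S : groupClosed G) : hom (subgroup_type S) G := val.

Lemma bounded_abelian_quotient A B (f : hom A B) :
  surjective f -> bounded_abelian C A -> bounded_abelian C B.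
Proof.
move=> fS [cA bA]; split=> [x y|N D [g [gS gN]] p pC].
  by have [[x' <-] [y' <-]] := (fS x, fS y); apply: gmulf_commute; apply: cA.
pose sN := subgrp_preim f (subgrp_carrier N).
apply: (bA (grp sN) D) pC; exists (hcomp g f); split=> [d|x].
  by have [b <-] := gS d; have [a <-] := fS b; exists a.
by rewrite grpE; apply: gN.
Qed.

(** A quotient of a subgroup of [A] is a subgroup of a quotient of [A], and
primary components of subgroups only get smaller. *)
Lemma bounded_abelian_sub D A (f : hom D A) :
  injective f -> bounded_abelian C A -> bounded_abelian C D.
Proof.
move=> fI [cA bA]; have cD : abelian D.
  by move=> x y; apply: fI; rewrite !gmulfM; apply: cA.
split=> // N B [g [gS gN]] p pC.
pose sN := subgrp_image f (subgrp_carrier N).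
have nN : normalized (f @` [set x | x \in N]).
  by move=> x y Nx; rewrite conjgE (cA x y) mulKg.
have [B' [g' [gS' gN']]] := quotient_exists sN nN.
have gg' x : g x = 1 <-> g' (f x) = 1.
  rewrite gN gN'; split=> [Nx|[y Ny /fI <-] //]; by exists x.
have [l lE] := @hom_factor _ _ _ g (hcomp g' f) gS (fun x => (gg' x).1).
have lI : injective l.
  apply: gmulf_inj => b; have [x <-] := gS b.
  by rewrite lE => /gg'.
have qB' : is_quotient (grp sN) B'.
  by exists g'; split=> // x; rewrite gN' grpE.
have lp b : primary_component p b -> primary_component p (l b).
  by move=> [k bk]; exists k; rewrite -gmulfXn bk gmulf1.
have [[n [n0 Bn]] [G [CG cG]]] := bA _ _ qB' p pC; split.
  exists n; split=> // b /lp/Bn; rewrite -gmulfXn => lb.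
  by apply: lI; rewrite lb gmulf1.
exists G; split=> //; apply: card_le_trans cG.
have lI' : {in @primary_component p B &, injective l}.
  by move=> x y _ _; apply: lI.
rewrite -(card_le_eql (inj_card_eq lI')); apply: subset_card_le.
by move=> _ [b pb <-]; apply: lp.
Qed.

Lemma factor_exists G (K H : groupClosed G) :
  (forall x g, x \in H -> g \in H -> x \in K -> x ^ g \in K) ->
  exists Q, is_factor K H Q.
Proof.
move=> nK.
have sK := subgrp_preim (incl H) (subgrp_carrier K).
have nK' : normalized (incl H @^-1` [set x | x \in K]).
  move=> x g Kx; suff: incl H (x ^ g) \in K by [].
  by rewrite gmulfJ; apply: nK => //; exact: valP.
have [Q [f [fS fK]]] := quotient_exists sK nK'.
by exists Q, f.
Qed.

Lemma factor_injective G B (f : hom G B) (L L' : groupClosed G)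
    (K K' : groupClosed B) Q :
  (forall x g, x \in L' -> g \in L' -> x \in L -> x ^ g \in L) ->
  (forall x, x \in L' -> f x \in K') ->
  (forall x, x \in L' -> f x \in K <-> x \in L) ->
  is_factor K K' Q ->
  exists Q', is_factor L L' Q' /\ exists l : hom Q' Q, injective l.
Proof.
move=> nL fL' fL [q [qS qK]]; have [Q' [q' [qS' qL]]] := factor_exists nL.
have [g gE] := @corestrict _ _ (hcomp f (incl L')) K' (fun x => fL' _ (valP x)).
have gq x : q' x = 1 <-> q (g x) = 1.
  by rewrite qL qK !inE gE; apply: iff_sym; apply: fL; apply: valP.
have [l lE] := @hom_factor _ _ _ q' (hcomp q g) qS' (fun x => (gq x).1).
exists Q'; split; first by exists q'.
exists l; apply: gmulf_inj => b; have [x <-] := qS' b.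
by rewrite lE => /gq.
Qed.

Lemma factor_surjective G B (f : hom G B) (L L' : groupClosed G)
    (K K' : groupClosed B) Q :
  (forall x g, x \in K' -> g \in K' -> x \in K -> x ^ g \in K) ->
  (forall x, x \in L' -> f x \in K') ->
  (forall y, y \in K' -> exists2 x, x \in L' & f x = y) ->
  (forall x, x \in L -> f x \in K) ->
  is_factor L L' Q ->
  exists Q', is_factor K K' Q' /\ exists l : hom Q Q', surjective l.
Proof.
move=> nK fL' fK' fL [q [qS qL]]; have [Q' [q' [qS' qK]]] := factor_exists nK.
have [g gE] := @corestrict _ _ (hcomp f (incl L')) K' (fun x => fL' _ (valP x)).
have gq x : q x = 1 -> q' (g x) = 1.
  by rewrite qL qK !inE gE; apply: fL.
have [l lE] := @hom_factor _ _ _ q (hcomp q' g) qS gq.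
exists Q'; split; first by exists q'.
exists l => b; have [y <-] := qS' b.
have [x Lx fx] := fK' _ (valP y).
exists (q (Sub x Lx)); rewrite lE; congr (q' _).
by apply: val_inj; rewrite gE.
Qed.

(** The kernel of [s] embeds in [B] and the image of [s] lies in [Q]: a bounded
series of [G] climbs through the kernel of [s] along the series of [B], then
through [G] along the series of [Q]. The case where [s] and [f] are equal
gives subgroups, the case of the two projections gives direct products. *)
Lemma bounded_nilpotent_joint G Q B (s : hom G Q) (f : hom G B) :
  (forall x, s x = 1 -> f x = 1 -> x = 1) ->
  bounded_nilpotent C Q -> bounded_nilpotent C B -> bounded_nilpotent C G.
Proof.
move=> sf [n [H [[H0 Hn Hnor Hi HR] Hb]]] [m [K [[K0 Km Knor Ki KR] Kb]]].
(* For [i <= m] the first condition says that [x] is in the kernel of [s], and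
   from [m] on the second one is void. *)
pose L i : set G := [set x | s x \in H (i - m)%N /\ f x \in K (minn i m)].
have sL i : subgrp (L i).
  apply: subgrpI; first exact: (subgrp_preim s (subgrp_carrier (H (i - m)%N))).
  exact: (subgrp_preim f (subgrp_carrier (K (minn i m)))).
have LE i x : reflect (L i x) (x \in grp (sL i)) by apply: (iffP idP) => /grpE.
have H1 i : 1 \in H i by exact: gpred1.
have nL i : (i <= m + n)%N -> normal (grp (sL i)).
  move=> imn x g /LE[Hx Kx]; apply/LE; split; rewrite gmulfJ.
    by apply: Hnor => //; rewrite leq_subLR.
  by apply: Knor => //; exact: geq_minr.
have step i : (i < m + n)%N ->
    [/\ (i < m)%N, i - m = 0, i.+1 - m = 0, minn i m = i & minn i.+1 m = i.+1]%N
    \/ [/\ i.+1 - m = (i - m).+1, (i - m < n)%N, minn i m = m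
         & minn i.+1 m = m]%N.
  move=> imn; have [im|] := boolP (i < m)%N.
    left.
    split=> //; [exact/eqP/ltnW|exact/eqP| |exact/minn_idPl].
    by apply/minn_idPl/ltnW.
  rewrite -leqNgt => im; right.
  split; [exact: subSn| |exact/minn_idPr|exact/minn_idPr/leqW].
  by rewrite ltn_subLR.
exists (m + n)%N, (fun i => grp (sL i)); split; first split.
- move=> x; apply/idP/idP => [/LE[]|/eqP->]; last exact: gpred1.
  rewrite sub0n min0n H0 K0 => /eqP s1 /eqP f1.
  by apply/eqP; apply: sf.
- move=> x; have e1 : ((m + n) - m = n)%N by rewrite addKn.
  have e2 : minn (m + n) m = m by apply/minn_idPr/leq_addr.
  by apply/idP/LE; split; rewrite ?e1 ?e2 ?Hn ?Km.
- exact: nL.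
- move=> i imn x /LE[Hx Kx]; apply/LE; split.
    have [[im i0 j0 ii jj]|[jj iN ii jm]] := step i imn.
      by rewrite j0 -i0.
    by rewrite jj; apply: Hi.
  have [[im i0 j0 ii jj]|[jj iN ii jm]] := step i imn.
    by rewrite jj; apply: Ki => //; move: Kx; rewrite ii.
  by rewrite jm -ii.
- move=> i imn x g /LE[Hx Kx]; apply/LE; split; rewrite gmulfR.
    have [[im i0 j0 ii jj]|[jj iN ii jm]] := step i imn.
      by move: Hx; rewrite j0 H0 => /eqP->; rewrite comm1g.
    by apply: HR => //; move: Hx; rewrite jj.
  have [[im i0 j0 ii jj]|[jj iN ii jm]] := step i imn.
    by rewrite ii; apply: KR => //; move: Kx; rewrite jj.
  by rewrite ii Km.
move=> i imn.
have nLi x g : x \in grp (sL i.+1) -> g \in grp (sL i.+1) -> x \in grp (sL i) ->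
    x ^ g \in grp (sL i) by move=> _ _; apply: nL => //; exact: ltnW.
have [[im i0 j0 ii jj]|[jj iN ii jm]] := step i imn.
  have [R [KR' bR]] := Kb i im.
  have [||Q' [LQ [l lI]]] := factor_injective (f := f) nLi _ _ KR'.
  - by move=> x /LE[_]; rewrite jj.
  - move=> x /LE[Hx Kx]; split=> [Kfx|/LE[_]]; last by rewrite ii.
    by apply/LE; split; [rewrite i0 -j0 | rewrite ii].
  by exists Q'; split=> //; exact: bounded_abelian_sub lI bR.
have [R [HR' bR]] := Hb _ iN.
have [||Q' [LQ [l lI]]] := factor_injective (f := s) nLi _ _ HR'.
- by move=> x /LE[]; rewrite jj.
- move=> x /LE[Hx Kx]; split=> [Hfx|/LE[]] //.
  by apply/LE; split=> //; rewrite ii -jm.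
by exists Q'; split=> //; exact: bounded_abelian_sub lI bR.
Qed.

Lemma bounded_nilpotent_quotient G (W : groupType) (f : hom G W) :
  surjective f ->
  bounded_nilpotent C G -> bounded_nilpotent C W.
Proof.
move=> fS [n [H [[H0 Hn Hnor Hi HR] Hb]]].
pose L i : set W := f @` [set x | x \in H i].
have sL i : subgrp (L i) by apply: subgrp_image; apply: subgrp_carrier.
have LE i x : reflect (L i x) (x \in grp (sL i)) by apply: (iffP idP) => /grpE.
have nL i : (i <= n)%N -> normal (grp (sL i)).
  move=> imn x g /LE[y Hy <-]; have [h <-] := fS g; apply/LE; exists (y ^ h).
    exact: Hnor.
  by rewrite gmulfJ.
exists n, (fun i => grp (sL i)); split; first split.
- move=> x; apply/idP/idP => [/LE[y /=]|/eqP->]; last exact: gpred1.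
  by rewrite H0 => /eqP-> <-; rewrite gmulf1 inE.
- move=> x; apply/idP/LE; have [y <-] := fS x; exists y => //=; by rewrite Hn.
- exact: nL.
- by move=> i imn x /LE[y Hy <-]; apply/LE; exists y => //; apply: Hi.
- move=> i imn x g /LE[y Hy <-]; have [h <-] := fS g; apply/LE; exists [~ y, h].
    exact: HR.
  by rewrite gmulfR.
move=> i imn.
have nLi x g : x \in grp (sL i.+1) -> g \in grp (sL i.+1) -> x \in grp (sL i) ->
    x ^ g \in grp (sL i) by move=> _ _; apply: nL => //; exact: ltnW.
have [R [KR' bR]] := Hb i imn.
have [|||Q' [LQ [l lI]]] := factor_surjective (f := f) nLi _ _ _ KR'.
- by move=> x Hx; apply/LE; exists x.
- by move=> y /LE[x Hx <-]; exists x.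
- by move=> x Hx; apply/LE; exists x.
by exists Q'; split=> //; exact: bounded_abelian_quotient lI bR.
Qed.

End Bounded.

(** * Abelian groups in a root class *)

Lemma coprime_expg (G : groupType) (a : G) m n :
  coprime m n -> a ^+ m = 1 -> a ^+ n = 1 -> a = 1.
Proof.
case: m => [|m]; first by rewrite /coprime gcd0n => /eqP->.
move=> /eqP cmn am an; case: (egcdnP n (ltn0Sn m)) => k l e _.
rewrite cmn in e; have := congr1 (fun i => a ^+ i) e.
by rewrite expgnDr expg1 (mulnC k) (mulnC l) !expgnA am an !expg1n mul1g.
Qed.

Lemma expg_ppart (G : groupType) (a : G) p n k : prime p -> (0 < n)%N ->
  a ^+ n = 1 -> a ^+ (p ^ k) = 1 -> a ^+ (p ^ logn p n) = 1.
Proof.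
move=> p_pr n0 an ak; have [m mp nE] := pfactor_coprime p_pr n0.
apply: (@coprime_expg _ _ m (p ^ k)).
- by rewrite coprime_sym coprimeXl.
- by rewrite -expgnA mulnC -nE.
by rewrite -expgnA mulnC expgnA ak expg1n.
Qed.

Lemma expg_prime_eq (G H : groupType) (a : G) (b : H) p i j : prime p ->
  a <> 1 -> a ^+ p = 1 -> b ^+ p = 1 -> a ^+ i = a ^+ j -> b ^+ i = b ^+ j.
Proof.
move=> p_pr a1 ap bp; wlog lij : i j / (i <= j)%N.
  move=> IH e; case: (leqP i j) => [ij|/ltnW ji]; first exact: IH.
  by apply/esym/IH.
rewrite -(subnKC lij) !expgnDr => e.
have {e}aji : a ^+ (j - i) = 1 by apply: (mulgI (a ^+ i)); rewrite -e mulg1.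
suff /dvdnP[k ->] : (p %| j - i)%N by rewrite mulnC expgnA bp expg1n mulg1.
apply: contra_notT a1; rewrite -prime_coprime // => cop.
exact: coprime_expg cop ap aji.
Qed.

Lemma hom_of_generator (G H : groupType) (a : G) (b : H) :
  (forall x, exists k, x = a ^+ k) ->
  (forall i j, a ^+ i = a ^+ j -> b ^+ i = b ^+ j) ->
  exists f : hom G H, f a = b.
Proof.
move=> genG ab; pose k x := sval (cid (genG x)).
have kE x : a ^+ k x = x by rewrite /k; case: cid.
have fM : {morph (fun x => b ^+ k x) : x y / x * y}.
  by move=> x y; rewrite -expgnDr; apply: ab; rewrite expgnDr !kE.
exists (mkhom fM); rewrite -[RHS]expg1; apply: ab.
by rewrite kE expg1.
Qed.

(** Zorn's lemma, in the form used twice below: a normal subgroup maximal among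
those avoiding a given set, here the complement of [R]. *)
Lemma maximal_normal (G : groupType) (R N0 : set G) :
  subgrp N0 -> normalized N0 -> N0 `<=` R ->
  exists N, [/\ subgrp N, normalized N, N0 `<=` N, N `<=` R &
    forall M, subgrp M -> normalized M -> N `<=` M -> M `<=` R -> M `<=` N].
Proof.
move=> sN0 nN0 N0R.
pose good N := [/\ subgrp N, normalized N, N0 `<=` N & N `<=` R].
(* Allowing [set0] takes care of the empty chain. *)
have [F FP Ftot|N [PN maxN]] := @Zorn_bigcup G (fun A => A = set0 \/ good A).
  have [allE|/existsNP[A0 /not_implyP[FA0 A00]]] :=
      pselect (forall A, F A -> A = set0).
    by left; rewrite -subset0 => x [A FA]; rewrite (allE A FA).
  have goodA A x : F A -> A x -> good A.
    by move=> /FP[->|].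
  have [//|gA0] := FP _ FA0.
  right; split.
  - split; first by exists A0 => //; case: gA0 => -[].
    move=> x y [A FA Ax] [B FB By].
    have [AB|BA] := Ftot A B FA FB.
      exists B => //; have [sB _ _ _] := goodA _ _ FB By.
      by apply: sB.2 => //; apply: AB.
    exists A => //; have [sA _ _ _] := goodA _ _ FA Ax.
    by apply: sA.2 => //; apply: BA.
  - move=> x g [A FA Ax]; exists A => //.
    by have [_ nA _ _] := goodA _ _ FA Ax; apply: nA.
  - by move=> x N0x; exists A0 => //; have [_ _ + _] := gA0; apply.
  - move=> x [A FA Ax].
    by have [_ _ _ AR] := goodA _ _ FA Ax; apply: AR.
have gN : good N.
  case: PN => // N_0; have g0 : good N0 by split.
  case: (maxN N0); last by right.
  by rewrite N_0; split=> // /(_ 1); apply; case: sN0.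
have [sN nN N0N NR] := gN; exists N; split=> // M sM nM NM MR.
apply: contrapT => MN; case: (maxN M) => //; right; split=> //.
exact: subset_trans NM.
Qed.

Section RootClass.
Variable C : group_class.
Hypotheses (rC : root_class C) (pC : forall G : groupType, C G -> periodic G).

Lemma root_injective (G H : groupType) (f : hom G H) :
  injective f -> C H -> C G.
Proof.
move=> fI CH; pose B := grp (subgrp_image f (@subgrpT G)).
have fB x : f x \in B by apply/grpE; exists x.
have [g gE] := corestrict fB.
have gS : surjective g.
  move=> b; have /grpE[x _ fx] := valP b; exists x; apply: val_inj.
  by rewrite gE fx.
have g1 x : g x = 1 -> idfun x = 1.
  by move=> gx; apply: fI; rewrite -gE gx gmulf1.
have [l lE] := @hom_factor _ _ _ g idfun gS g1.
apply: (root_iso rC) (root_subgroup rC B CH); exists l; exists g => // b.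
by have [x <-] := gS b; rewrite lE.
Qed.

Lemma prime_order_element p : p \in primes_of C ->
  prime p /\ exists (G : groupType) (z : G), [/\ C G, z <> 1 & z ^+ p = 1].
Proof.
move=> /asboolP[p_pr [G [x [n [CG [n0 xn minn] pn]]]]]; split=> //.
exists G, (x ^+ (n %/ p)); split=> //; last by rewrite -expgnA divnK.
move=> /minn; rewrite divn_gt0 ?prime_gt0 // (dvdn_leq n0 pn) => /(_ isT).
by rewrite leqNgt ltn_Pdiv // prime_gt1.
Qed.

Lemma primes_of_nonempty : exists p, p \in primes_of C.
Proof.
have [G [CG [x x1]]] := root_nontrivial rC.
have [n [n0 xn]] := pC CG x.
have exn : exists n, (0 < n)%N && (x ^+ n == 1) by exists n; rewrite n0 xn eqxx.
case: (ex_minnP exn) => m /andP[m0 /eqP xm] minm.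
have m1 : (1 < m)%N.
  by case: m m0 xm {minm} => [|[|]] // _; rewrite expg1.
exists (pdiv m); apply/asboolP; split; first exact: pdiv_prime.
exists G, x, m; split=> //; last exact: pdiv_dvd.
by split=> // k k0 xk; apply: minm; rewrite k0 xk eqxx.
Qed.

(** Let [N] be a subgroup of [A] maximal among those that do not contain [a].
Every nontrivial subgroup of [A / N] contains the image of [a], so that this
image generates [A / N], a cyclic group of order [p]; it can be sent to [z].
This replaces the choice of a basis of [A] over the field with [p] elements. *)
Lemma separating_character (A G : groupType) (z : G) p (a : A) : prime p ->
  abelian A -> (forall x : A, x ^+ p = 1) -> a <> 1 -> z ^+ p = 1 ->
  exists f : hom A G, f a = z.
Proof.
move=> p_pr cA Ap a1 zp.
have nA (H : groupType) : abelian H -> forall B : set H, normalized B.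
  by move=> cH B x g Bx; rewrite conjgE (cH x g) mulKg.
have [|N [sN nN _ Na maxN]] :=
  @maximal_normal A (~` [set a]) [set 1] (subgrp1 A) (nA _ cA _).
  by move=> _ -> /esym.
have [Q [f [fS fN]]] := quotient_exists sN nN.
have cQ : abelian Q.
  move=> x y; have [[x' <-] [y' <-]] := (fS x, fS y).
  exact/gmulf_commute/cA.
have Qp (u : Q) : u ^+ p = 1 by have [x <-] := fS u; rewrite -gmulfXn Ap gmulf1.
have fa : f a <> 1 by move=> /fN /Na; apply.
have gen (u : Q) : exists k, u = f a ^+ k.
  have [->|/eqP u1] := eqVneq u 1; first by exists 0.
  have [x fx] := fS u.
  have [j aj] : exists j, f a = u ^+ j.
    apply: contrapT => noj; apply: u1; rewrite -fx; apply/fN.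
    have scu := subgrp_cyc u.
    apply: (maxN (f @^-1` cyc u)).
    - exact: subgrp_preim.
    - exact: nA.
    - by move=> y /fN fy; rewrite /preimage /= fy; case: scu.
    - move=> y [k [l fy]] ya; apply: noj; exists (k + l * p.-1)%N.
      rewrite -ya fy expgnDr; congr (_ * _).
      apply: (mulgI (u ^+ l)); rewrite mulgV -expgnDr -mulnS.
      rewrite prednK ?prime_gt0 //.
      by rewrite mulnC expgnA Qp expg1n.
    - by rewrite /preimage /= fx; exact: cyc_id.
  have cjp : coprime p j.
    rewrite prime_coprime //; apply: contra_notN fa => /dvdnP[k jk].
    by rewrite aj jk mulnC expgnA Qp expg1n.
  have j0 : (0 < j)%N.
    by case: j aj cjp => // aj; rewrite expg0 in aj.
  case: (egcdnP p j0) => k l; rewrite gcdnC (eqP cjp) => e _; exists k.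
  by rewrite aj -expgnA mulnC e expgnDr mulnC expgnA Qp expg1n mul1g.
have [|g ga] := @hom_of_generator _ G (f a) z gen.
  by move=> i j; apply: expg_prime_eq p_pr fa (Qp _) zp.
by exists (hcomp g f); rewrite -ga.
Qed.

(** For each nontrivial [a] there is a character of [A] with values in a C-group
that does not vanish at [a]. Indexing these characters by [Y], through the
injection [i], embeds [A] in a Cartesian power of a C-group over [Y]. *)
Lemma elementary_in_root (A Y : groupType) p (i : A -> Y) : p \in primes_of C ->
  abelian A -> (forall x : A, x ^+ p = 1) -> injective i -> C Y -> C A.
Proof.
move=> /prime_order_element[p_pr [G [z [CG z1 zp]]]] cA Ap iI CY.
have chi_ex y : exists f : hom A G, forall a, i a = y -> a <> 1 -> f a = z.
  have [[a [ia a1]]|no] := pselect (exists a, i a = y /\ a <> 1).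
    have [f fa] := separating_character p_pr cA Ap a1 zp.
    by exists f => b; rewrite -ia => /iI->.
  by exists (@one_fun A G) => a ia a1; case: no; exists a.
have [chi chiE] := choice chi_ex.
pose F a : cartesian_product (fun _ : Y => G) := fun y => chi y a.
have fM : {morph F : a b / a * b}.
  by move=> a b; apply: functional_extensionality_dep => y; apply: gmulfM.
apply: (@root_injective _ _ (mkhom fM)).
  apply: gmulf_inj => a /(congr1 (@^~ (i a))) chi1; apply: contrapT => a1.
  by apply: z1; rewrite -(chiE (i a) a).
by apply: (root_product rC) CG CY _ => y; exists idfun; exists id.
Qed.

(** Induction on the exponent: [A] is an extension of an elementary abelian
group, the kernel of the map raising to the power [p], by the image of this
map. Both are subgroups of [A], so their cardinality is bounded as well. *)
Lemma finite_exponent_in_root (A Y : groupType) p e (i : A -> Y) :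
  p \in primes_of C -> abelian A -> (forall x : A, x ^+ (p ^ e) = 1) ->
  injective i -> C Y -> C A.
Proof.
move=> pP; elim: e A i => [|e IHe] A i cA Ae iI CY.
  apply: (@root_injective _ _ (@one_fun A Y)) CY => x y _.
  by rewrite -(expg1 x) -(expg1 y) -(expn0 p) !Ae.
have fM : {morph (fun a : A => a ^+ p) : a b / a * b}.
  by move=> a b; apply/expgMn/cA.
pose f : hom A A := mkhom fM.
pose K := grp (subgrp_preim f (subgrp1 A)).
pose B := grp (subgrp_image f (@subgrpT A)).
have cS (S : groupClosed A) : abelian (subgroup_type S).
  by move=> x y; apply: val_inj; rewrite !gmulfM; apply: cA.
have iS (S : groupClosed A) : injective (i \o val : subgroup_type S -> Y).
  by move=> x y /iI /val_inj.
have fB x : f x \in B by apply/grpE; exists x.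
have [g gE] := corestrict fB.
apply: (root_extension rC (N := K) (Q := subgroup_type B)).
- exists g; split=> [b|x].
    have /grpE[x _ fx] := valP b; exists x; apply: val_inj.
    by rewrite gE fx.
  split=> [gx|/grpE fx]; last by apply: val_inj; rewrite gE gmulf1; exact: fx.
  by apply/grpE; have := gE x; rewrite gx gmulf1 => /esym.
- apply: (elementary_in_root pP (cS K) _ (iS K) CY) => x.
  by have /grpE fx := valP x; apply: val_inj; rewrite gmulfXn gmulf1.
apply: (IHe _ _ (cS B) _ (iS B) CY) => b; apply: val_inj.
have /grpE[x _ fx] := valP b.
have be : val b ^+ (p ^ e) = 1 by rewrite -fx /= /morph_fun -expgnA -expnS Ae.
by rewrite gmulfXn gmulf1; exact: be.
Qed.

Lemma bounded_abelian_in_root (A : groupType) p : p \in primes_of C ->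
  bounded_abelian C A -> (forall x : A, exists k, x ^+ (p ^ k) = 1) -> C A.
Proof.
move=> pP [cA bA] Ap.
have qA : is_quotient (trivial_subgroup A) A.
  exists idfun; split=> [x|x]; first by exists x.
  by split=> [/eqP|/eqP].
have [[n [n0 An]] [G [CG /card_leP[i]]]] := bA _ _ qA p pP.
have [p_pr _] := prime_order_element pP.
have mem x : @primary_component p A x by apply: Ap.
pose j x := val (i (Sub x (mem_set (mem x)))).
apply: (@finite_exponent_in_root A G p (logn p n) j) => // [x|x y].
  by have [k xk] := Ap x; exact: expg_ppart p_pr n0 (An _ (mem x)) xk.
move=> /val_inj /(inj (mem_set I) (mem_set I)).
by move=> /(congr1 val).
Qed.

Lemma root_series (G : groupType) n (H : nat -> groupClosed G) :
  central_series n H ->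
  (forall i, (i < n)%N -> exists Q, is_factor (H i) (H i.+1) Q /\ C Q) -> C G.
Proof.
move=> [H0 Hn Hnor Hi HR] HC.
have CH i : (i <= n)%N -> C (subgroup_type (H i)).
  elim: i => [_|i IHi lin].
    have [Y [CY _]] := root_nontrivial rC.
    apply: (@root_injective _ _ (@one_fun (subgroup_type (H 0)) Y)) CY => x y _.
    apply: val_inj; have := valP x; have := valP y; rewrite !H0 !inE.
    by move=> /eqP-> /eqP->.
  have [Q [[f [fS fK]] CQ]] := HC i lin.
  pose N := grp (subgrp_preim (incl (H i.+1)) (subgrp_carrier (H i))).
  apply: (root_extension rC (N := N) (Q := Q)) => //.
    exists f; split=> // x; rewrite grpE fK; exact: iff_refl.
  have mem (x : subgroup_type N) : hcomp (incl (H i.+1)) (incl N) x \in H i.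
    by have /grpE := valP x.
  have [g gE] := corestrict mem.
  apply: (root_injective (f := g)); last by apply: IHi; exact: ltnW.
  move=> x y /(congr1 val); rewrite !gE => /val_inj /val_inj //.
have mem (x : G) : idfun x \in H n by rewrite Hn.
have [g gE] := corestrict (f := idfun) mem.
apply: (root_injective (f := g)) (CH n (leqnn n)) => x y /(congr1 val).
by rewrite !gE.
Qed.
End RootClass.

(** * Exponent of a nilpotent group *)

Lemma cseries_of_central (G : groupType) n (H : nat -> groupClosed G) :
  central_series n H -> exists H', cseries [set: G] n H'.
Proof.
move=> [H0 Hn Hnor Hi HR].
exists (fun i => [set x | x \in H (minn i n)]); split.
- by move=> i; apply: subgrp_carrier.
- by move=> x /=; rewrite min0n H0 => /eqP.
- by move=> x _ /=; rewrite minnn Hn.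
- move=> i x /=; have [lin|nli] := boolP (i < n)%N.
    by rewrite (minn_idPl lin) (minn_idPl (ltnW lin)); apply: Hi.
  by rewrite -leqNgt in nli; rewrite !(minn_idPr _) ?Hn // leqW.
move=> i x g _ _ /=; have [lin|nli] := boolP (i < n)%N.
  by rewrite (minn_idPl lin) (minn_idPl (ltnW lin)); apply: HR.
by rewrite -leqNgt in nli; rewrite !(minn_idPr _) ?Hn // leqW.
Qed.

Lemma central_of_cseries (G : groupType) n (H : nat -> set G) :
  cseries [set: G] n H -> exists H' : nat -> groupClosed G, central_series n H'.
Proof.
move=> csH; have [sH H0 Hn Hi HR] := csH; exists (fun i => grp (sH i)); split.
- move=> x; apply/idP/idP => [/grpE /H0 ->|/eqP->]; last exact: gpred1.
  by rewrite inE.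
- by move=> x; apply/idP; apply/grpE; apply: Hn.
- by move=> i _ x g /grpE Hx; apply/grpE; apply: (cseries_normal csH).
- by move=> i _ x /grpE Hx; apply/grpE; apply: Hi.
by move=> i _ x g /grpE Hx; apply/grpE; apply: HR.
Qed.

Section CentreMod.
Variable G : groupType.
Implicit Types (D : set G).

Definition centre_mod D : set G := [set x | forall g, D [~ x, g]].

Lemma subgrp_centre_mod D : subgrp D -> normalized D -> subgrp (centre_mod D).
Proof.
move=> sD nD; split=> [g|x y Dx Dy g]; first by rewrite comm1g; case: sD.
have -> : [~ x / y, g] = ([~ x, g] / [~ y, g]) ^ y^-1 by group_identity.
by apply/nD/sD.2; [apply: Dx | apply: Dy].
Qed.

Lemma normalized_centre_mod D : normalized D -> normalized (centre_mod D).
Proof.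
move=> nD x h Dx g.
have -> : [~ x ^ h, g] = [~ x, g ^ h^-1] ^ h by group_identity.
exact/nD/Dx.
Qed.

(** Commuting with [g] is multiplicative, modulo [D], on the powers of [x] once
[[~ x, g]] is central modulo [D]. *)
Lemma commg_expl_mod D x g k : subgrp D -> normalized D ->
  centre_mod D [~ x, g] -> D ([~ x, g] ^- k * [~ x ^+ k, g]).
Proof.
move=> sD nD Dc; set c := [~ x, g] in Dc *.
elim: k => [|k IHk]; first by rewrite !expg0 comm1g invg1 mulg1; case: sD.
have -> : c ^- k.+1 * [~ x ^+ k.+1, g] =
    ([~ c ^+ k, x] * (c ^- k * [~ x ^+ k, g]) ^ x) ^ c.
  rewrite !expgSr; move: (c ^+ k) (x ^+ k) => u v; rewrite /c.
  by group_identity.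
apply: (nD); apply: sgM => //; last exact: nD IHk.
exact: (sgX k (subgrp_centre_mod sD nD) Dc).
Qed.

Fixpoint upper_central i : set G :=
  if i is i'.+1 then centre_mod (upper_central i') else [set 1].

Lemma upper_central_normal i :
  subgrp (upper_central i) /\ normalized (upper_central i).
Proof.
elim: i => [|i [sU nU]] /=.
  by split; [exact: subgrp1 | move=> _ g ->; rewrite conj1g].
by split; [exact: subgrp_centre_mod | exact: normalized_centre_mod].
Qed.

(** Modulo the term below, [[~ x ^+ e, g]] is [[~ x, g] ^+ e], and [[~ x, g]]
is one step lower in the upper central series. *)
Lemma upper_central_exponent e :
  (forall x : G, (forall g, commute x g) -> x ^+ e = 1) ->
  forall i x, upper_central i.+1 x -> upper_central i (x ^+ e).
Proof.
move=> Ze; elim=> [|i IHi] x Ux.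
  by apply: Ze => g; apply/commgP/eqP/Ux.
move=> g; have [sU nU] := upper_central_normal i.
rewrite -[[~ _, _]](mulVKg ([~ x, g] ^+ e)).
by apply: sgM => //; [apply/IHi/Ux | apply: commg_expl_mod => //; apply: Ux].
Qed.

Lemma nilpotent_exponent n (H : nat -> set G) e : cseries [set: G] n H ->
  (forall x : G, (forall g, commute x g) -> x ^+ e = 1) ->
  forall x : G, x ^+ (e ^ n) = 1.
Proof.
move=> [sH H0 Hn Hi HR] Ze x.
have HU i y : H i y -> upper_central i y.
  by elim: i y => [y /H0//|i IHi y Hy g]; apply/IHi/HR.
have Ue i y : upper_central i y -> y ^+ (e ^ i) = 1.
  elim: i y => [y ->|i IHi y /(upper_central_exponent Ze)/IHi].
    exact: expg1n.
  by rewrite -expgnA -expnS.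
by apply/Ue/HU/Hn.
Qed.
End CentreMod.

(** * Separability in bounded nilpotent groups *)

Section Separability.
Variable C : group_class.
Hypotheses (rC : root_class C) (pC : forall G : groupType, C G -> periodic G).
Local Notation P := (primes_of C).

Lemma isolated_pnat (pi : nat_pred) (G : groupType) (Y : {pred G}) :
  isolated pi Y -> forall x q, pi.-nat q -> x ^+ q \in Y -> x \in Y.
Proof.
move=> isoY x q; have [n] := ubnP q; elim: n q => // n IHn q qn piq Yq.
have q0 : (0 < q)%N by case/andP: piq.
have [q1|q1] := leqP q 1.
  have e : q = 1%N by apply/eqP; rewrite eqn_leq q1.
  by rewrite e expg1 in Yq.
have p_pr := pdiv_prime q1; have pq := pdiv_dvd q.
have pip : pdiv q \in pi.
  by apply: (pnatPpi piq); rewrite mem_primes p_pr q0.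
apply: (IHn (q %/ pdiv q)%N).
- exact: leq_trans (ltn_Pdiv (prime_gt1 p_pr) q0) qn.
- exact: pnat_dvd (dvdn_div pq) piq.
by apply: (isoY _ _ p_pr pip); rewrite -expgnA divnK.
Qed.

(** If no positive power of [h] is in [J], any prime of the class will do.
Otherwise let [m] be the least exponent [r > 0] with [h ^+ r] in [J]. It
divides every such [r], and not all its prime factors are outside [P], for [J]
contains the [P^']-roots of its elements. When [h] normalizes [J], the
conclusion means that [h] is not in the product of [J] and the subgroup
generated by [h ^+ p]. *)
Lemma avoiding_prime (G : groupType) (J : set G) h : subgrp J ->
  (forall x q, P^'.-nat q -> J (x ^+ q) -> J x) -> ~ J h ->
  exists p, p \in P /\ forall r, (0 < r)%N -> J (h ^+ r) -> (p %| r)%N.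
Proof.
move=> sJ isoJ Jh.
have [[r [r0 Jr]]|no] := pselect (exists r, (0 < r)%N /\ J (h ^+ r));
  last first.
  have [p pP] := primes_of_nonempty rC pC; exists p; split=> // r r0 Jr.
  by case: no; exists r.
have ex : exists r, (0 < r)%N && `[< J (h ^+ r) >].
  by exists r; rewrite r0; apply/asboolP.
case: (ex_minnP ex) => m /andP[m0 /asboolP Jm] minm.
have /allPn[p pm pP] : ~~ all (mem P^') (primes m).
  apply: contra_notN Jh => am; apply: (isoJ _ m) => //.
  by rewrite /pnat m0.
have memC (pi : nat_pred) : p \notin pi^' -> p \in pi by rewrite inE /= negbK.
exists p; split; first exact: memC.
move=> k k0 Jk; move: pm; rewrite mem_primes => /and3P[_ _ pm].
apply: dvdn_trans pm _; rewrite /dvdn; apply: contraT => km0.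
have := minm (k %% m)%N; rewrite lt0n km0 /= => /(_ _)/wrap[].
  apply/asboolP; rewrite {1}(divn_eq k m) expgnDr in Jk.
  rewrite -[h ^+ _](mulKg (h ^+ (k %/ m * m))); apply: sgM => //.
  by apply: sgV => //; rewrite mulnC expgnA; apply: sgX.
by rewrite leqNgt ltn_mod m0.
Qed.

Lemma cyc_sub (G : groupType) (A : set G) x : subgrp A -> A x -> cyc x `<=` A.
Proof. by move=> sA Ax _ [k [l ->]]; apply: sA.2; apply: sgX. Qed.

Lemma subgrp_centre (G : groupType) :
  subgrp [set x : G | forall g, commute x g].
Proof.
split=> [g|x y cx cy g]; first exact/commute_sym/commute1.
apply/commute_sym/commuteM; first exact/commute_sym/cx.
exact/commuteV/commute_sym/cy.
Qed.

(** The quotient is by a normal subgroup [N] containing [D] and [h ^+ p] and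
maximal such that [h] is not in [J N]. Write [k] for the image of [h]. By
maximality, each nontrivial central subgroup [V] of [W] satisfies: [k] is in
[f(J) V]. Applied to a central subgroup of [f(J)], this is absurd, so [f(J)]
has no nontrivial central element; and then [k] being in [f(J) V] forces [k],
which is central, to be in [V]. As [k] has order [p], every central element
has [p]-power order. *)
Lemma monolithic_quotient (G : groupType) (D J : set G) h p :
  prime p -> subgrp D -> normalized D -> subgrp J -> D `<=` J ->
  centre_mod D h -> (forall r, (0 < r)%N -> J (h ^+ r) -> (p %| r)%N) ->
  exists (W : groupType) (f : hom G W),
    [/\ surjective f, ~ (f @` J) (f h) &
      forall v : W, (forall g, commute v g) -> exists k, v ^+ (p ^ k) = 1].
Proof.
move=> p_pr sD nD sJ DJ Dh pJ.
pose N0 := setmul (cyc (h ^+ p)) D; pose R := [set b | ~ J (h / b)].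
have sN0 : subgrp N0.
  by apply: subgrp_setmul => //; [exact: subgrp_cyc | move=> s r _; apply: nD].
have cD : cyc (h ^+ p) `<=` centre_mod D.
  have sc := subgrp_centre_mod sD nD.
  exact: cyc_sub sc (sgX p sc Dh).
have nN0 : normalized N0.
  move=> _ g [w [d [cw Dd ->]]]; exists w, ([~ w, g] * d ^ g).
  split=> //; last by group_identity.
  by apply: sgM => //; [apply: cD | apply: nD].
have N0R : N0 `<=` R.
  move=> _ [w [d [[k [l wE]] Dd ->]]] Jwd.
  have {Jwd} : J (h / w).
    have -> : h / w = h / (w * d) * d ^ w^-1 by group_identity.
    by apply: sgM => //; apply/DJ/nD.
  rewrite {}wE invgF mulgA -!expgnA -expgS.
  (* [h ^+ (p * l).+1 / h ^+ (p * k)] is in [J], although its exponent is not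
     divisible by [p]. *)
  have pS r : (p %| (p * r).+1)%N = false.
    by rewrite -addn1 dvdn_addr ?dvdn_mulr // dvdn1 gtn_eqF ?prime_gt1.
  have [lt|lt|e] := ltngtP (p * l).+1 (p * k)%N => Jkl.
  - have /pJ : J (h ^+ (p * k - (p * l).+1)).
      by rewrite expgnFr 1?ltnW // -invgF; apply: sgV.
    by rewrite subn_gt0 => /(_ lt); rewrite dvdn_subr ?dvdn_mulr ?pS // ltnW.
  - have /pJ : J (h ^+ ((p * l).+1 - p * k)) by rewrite expgnFr 1?ltnW.
    by rewrite subn_gt0 => /(_ lt); rewrite dvdn_subl ?dvdn_mulr ?pS // ltnW.
  by have := pS l; rewrite e dvdn_mulr.
have [N [sN nN N0N NR maxN]] := maximal_normal sN0 nN0 N0R.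
have [W [f [fS fN]]] := quotient_exists sN nN.
have fhJ : ~ (f @` J) (f h).
  move=> [a Ja fa]; have /NR : N (a^-1 * h).
    by apply/fN; rewrite gmulfM gmulfV fa mulVg.
  by apply; rewrite invgM invgK mulgA mulgV mul1g.
have sfJ : subgrp (f @` J) by exact: subgrp_image.
have fh1 : f h <> 1 by move=> e; apply: fhJ; rewrite e; case: sfJ.
have fhp : f h ^+ p = 1.
  rewrite -gmulfXn; apply/fN/N0N; apply: setmull; first by case: sD.
  exact: cyc_id.
have fhc g : commute (f h) g.
  have [g' <-] := fS g; apply/commgP/eqP; rewrite -gmulfR; apply/fN/N0N.
  by apply: setmulr; [case: (subgrp_cyc (h ^+ p)) | apply: Dh].
have cent (v : W) : (forall g, commute v g) ->
    forall w, cyc v w -> forall g, commute w g.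
  by move=> cv; exact: cyc_sub (subgrp_centre W) cv.
have mono (v : W) : (forall g, commute v g) -> v <> 1 ->
    exists a w, [/\ J a, cyc v w & f h = f a * w].
  move=> cv v1; apply: contrapT => no; have [x fx] := fS v.
  apply: v1; rewrite -fx; apply/fN; apply: (maxN (f @^-1` cyc v)).
  - exact: subgrp_preim (subgrp_cyc v).
  - apply: normalized_preim => w g cw.
    by have /conjg_fixP -> : [~ w, g] == 1 by apply/commgP; apply: cent cw _.
  - by move=> y /fN fy; rewrite /preimage /= fy; case: (subgrp_cyc v).
  - move=> b cb Jhb; apply: no; exists (h / b), (f b); split=> //.
    by rewrite gmulfF mulgVK.
  by rewrite /preimage /= fx; exact: cyc_id.
have JZ a : J a -> (forall g, commute (f a) g) -> f a = 1.
  move=> Ja ca; apply: contrapT => a1; have [a' [w [Ja' cw e]]] := mono _ ca a1.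
  apply: fhJ; rewrite e; apply: (sgM sfJ); first by exists a'.
  by apply: (cyc_sub sfJ _ cw); exists a.
have {}mono (v : W) : (forall g, commute v g) -> v <> 1 -> cyc v (f h).
  move=> cv v1; have [a [w [Ja cw e]]] := mono _ cv v1.
  have fa : f a = f h / w by rewrite e mulgK.
  suff a1 : f a = 1 by rewrite e a1 mul1g.
  apply: JZ => // g; rewrite fa; apply: (subgrp_centre W).2 => //.
  exact: cent cw.
exists W, f; split=> // v cv.
have [->|/eqP v1] := eqVneq v 1; first by exists 0; rewrite expg1n.
have [s s0 vs] : exists2 s, (0 < s)%N & v ^+ s = 1.
  have [i [j e]] := mono v cv v1.
  have vp : v ^+ (p * i) = v ^+ (p * j).
    apply: divg1_eq; rewrite ![(p * _)%N]mulnC !expgnA -expgnFl -?e //.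
    exact: commuteX2.
  have [ij|ij|ij] := ltngtP i j; last by rewrite e ij mulgV in fh1.
    exists (p * j - p * i)%N; first by rewrite subn_gt0 ltn_pmul2l // prime_gt0.
    by rewrite expgnFr ?vp ?mulgV // leq_pmul2l ?prime_gt0 // ltnW.
  exists (p * i - p * j)%N; first by rewrite subn_gt0 ltn_pmul2l // prime_gt0.
  by rewrite expgnFr ?vp ?mulgV // leq_pmul2l ?prime_gt0 // ltnW.
have [m mp sE] := pfactor_coprime p_pr s0.
exists (logn p s); apply: contrapT => u1.
have cu : forall g, commute (v ^+ (p ^ logn p s)) g.
  exact: (sgX _ (@subgrp_centre W)).
have [i [j e]] := mono _ cu u1.
apply: fh1; apply: (coprime_expg mp fhp).
rewrite e expgnFl; last exact: commuteX2.
have um : v ^+ (p ^ logn p s) ^+ m = 1 by rewrite -expgnA mulnC -sE.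
by rewrite (expgnAC _ i m) (expgnAC _ j m) um !expg1n mulgV.
Qed.

(** Each factor of a bounded series has [p]-primary component of finite
exponent; intersecting the series with the centre, a [p]-group, shows that the
centre has finite exponent. Then [W] has finite [p]-power exponent, and its
factors are in C. *)
Lemma torsion_centre_in_root (W : groupType) p : p \in P ->
  bounded_nilpotent C W ->
  (forall v : W, (forall g, commute v g) -> exists k, v ^+ (p ^ k) = 1) -> C W.
Proof.
move=> pP [n [H [csH bH]]] Zp; have [p_pr _] := prime_order_element pP.
have [H0 Hn Hnor Hi HR] := csH.
have expH i : (i <= n)%N -> exists e, (0 < e)%N /\
    forall v : W, (forall g, commute v g) -> v \in H i -> v ^+ e = 1.
  elim: i => [_|i IHi lin].
    by exists 1%N; split=> // v _; rewrite H0 expg1 => /eqP.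
  have [e [e0 He]] := IHi (ltnW lin).
  have [Q [[f [fS fK]] [_ bQ]]] := bH i lin.
  have qQ : is_quotient (trivial_subgroup Q) Q.
    by exists idfun; split=> [x|x]; [exists x | split=> [/eqP|/eqP]].
  have [[m [m0 Qm]] _] := bQ _ _ qQ p pP.
  exists (m * e)%N; split=> [|v cv Hv]; first by rewrite muln_gt0 m0.
  rewrite expgnA; apply: He; first exact: (sgX _ (@subgrp_centre W)).
  have [k vk] := Zp v cv.
  pose v' : subgroup_type (H i.+1) := Sub v Hv.
  have valX j : val (v' ^+ j) = v ^+ j by rewrite gmulfXn.
  have vk1 : v' ^+ (p ^ k) = 1 by apply: val_inj; rewrite valX vk.
  have /fK : f (v' ^+ m) = 1.
    by rewrite gmulfXn; apply: Qm; exists k; rewrite -gmulfXn vk1 gmulf1.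
  by rewrite inE valX.
have [e [e0 He]] := expH n (leqnn n).
have [H' csH'] := cseries_of_central csH.
have Wp := nilpotent_exponent (e := p ^ logn p e) csH'.
apply: (root_series rC csH) => i lin.
have [Q [KQ bQ]] := bH i lin; exists Q; split=> //.
apply: (bounded_abelian_in_root rC pP bQ) => x.
have [f [fS fK]] := KQ; have [y <-] := fS x.
exists (logn p e * n)%N; rewrite -gmulfXn; apply/fK.
have -> : y ^+ (p ^ (logn p e * n)) = 1; last exact: gpred1.
apply: val_inj; rewrite gmulfXn expnM gmulf1; apply: Wp => v cv.
have [k vk] := Zp v cv.
by apply: expg_ppart vk => //; apply: He; rewrite ?Hn.
Qed.

Lemma nilpotent_of_bounded (G : groupType) :
  bounded_nilpotent C G -> nilpotent G.
Proof. by move=> [n [H [csH _]]]; exists n, H. Qed.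

(** Let [J i] be the group of roots of [Y (H i)]. As [x] is outside [J 0 = Y],
there is a last [i] with [x] outside [J i]; some [P^']-power of [x] is then
[a * h] with [a] in [Y] and [h] in [H i.+1]. It is enough to separate [h] from
[J i], which contains [Y]: a homomorphism sending [x] into the image of [Y]
also sends [h] there. *)
Lemma bounded_separable (G : groupType) (Y : set G) x :
  bounded_nilpotent C G -> subgrp Y ->
  (forall y q, P^'.-nat q -> Y (y ^+ q) -> Y y) -> ~ Y x ->
  exists (W : groupType) (f : hom G W),
    nilpotent_class C W /\ ~ (f @` Y) (f x).
Proof.
move=> bG sI isoI Ix; have [n [H0 csH0]] := nilpotent_of_bounded bG.
have {csH0}[H csH] := cseries_of_central csH0.
have [sH H0' Hn Hi HR] := csH.
have nH i : normalized (H i) by move=> y g; apply: (cseries_normal csH).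
pose J i := roots P^' setT (setmul Y (H i)).
have sIH i : subgrp (setmul Y (H i)).
  by apply: subgrp_setmul => // s r _; apply: nH.
have IHJ i : setmul Y (H i) `<=` J i by exact: sub_roots.
have sJ i : subgrp (J i) by apply: subgrp_roots csH _ _.
have isoJ i y q : P^'.-nat q -> J i (y ^+ q) -> J i y.
  by move=> piq Jy; apply: rootsK; split=> //; exists q.
have [i [Jxi [_ [q [piq [a [h [Ia Hh xq]]]]]]]] : exists i, ~ J i x /\ J i.+1 x.
  apply: contrapT => no; suff : ~ J n x.
    apply; apply: IHJ; apply: setmulr; [by case: sI | exact: Hn].
  elim: (n) => [[_ [q [piq [a [h [Ia /H0' -> xq]]]]]]|m IHm Jm].
    by apply: Ix; apply: (isoI _ _ piq); rewrite xq mulg1.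
  by apply: no; exists m.
have Jh : ~ J i h.
  move=> Jh; apply: Jxi; apply: (isoJ _ _ _ piq); rewrite xq.
  by apply: sgM => //; apply/IHJ/setmull => //; case: (sH i).
have [p [pP pJ]] := avoiding_prime (sJ i) (isoJ i) Jh.
have [p_pr _] := prime_order_element pP.
have HJ : H i `<=` J i by move=> y Hy; apply/IHJ/setmulr => //; case: sI.
have cHh : centre_mod (H i) h by move=> g; apply: HR.
have [W [f [fS fhJ Zp]]] :=
  monolithic_quotient p_pr (sH i) (nH i) (sJ i) HJ cHh pJ.
have bW := bounded_nilpotent_quotient fS bG.
exists W, f; split.
  by split; [exact: nilpotent_of_bounded | exact: torsion_centre_in_root bW Zp].
move=> [b Ib fb]; apply: fhJ; exists (a^-1 * b ^+ q).
  apply/IHJ/setmull; first by case: (sH i).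
  by apply: sgM => //; [apply: sgV | apply: sgX].
by rewrite gmulfM gmulfV gmulfXn fb -gmulfXn xq gmulfM mulKg.
Qed.
End Separability.

(** * Nilpotency class and roots *)

Section Nilpotent.
Implicit Types (G A E : groupType).

Lemma cseries_preim A G (f : hom A G) n (H : nat -> set G) : injective f ->
  cseries [set: G] n H -> cseries [set: A] n (fun i => f @^-1` H i).
Proof.
move=> fI [sH H0 Hn Hi HR]; split.
- by move=> i; apply: subgrp_preim.
- by move=> x /H0 fx; apply: fI; rewrite [LHS]fx gmulf1.
- by move=> x _; apply: Hn.
- by move=> i x; apply: Hi.
by move=> i x g _ _ Hx; rewrite /preimage /= gmulfR; apply: HR.
Qed.

Lemma cseries_image G E (f : hom G E) n (H : nat -> set G) : surjective f ->
  cseries [set: G] n H -> cseries [set: E] n (fun i => f @` H i).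
Proof.
move=> fS [sH H0 Hn Hi HR]; split.
- by move=> i; apply: subgrp_image.
- by move=> _ [x /H0 -> <-]; rewrite gmulf1.
- by move=> y _; have [x <-] := fS y; exists x => //; apply: Hn.
- by move=> i _ [x Hx <-]; exists x => //; apply: Hi.
move=> i _ g _ _ [x Hx <-]; have [y <-] := fS g; rewrite -gmulfR.
by exists [~ x, y] => //; apply: HR.
Qed.

Lemma nilpotent_injective A G (f : hom A G) :
  injective f -> nilpotent G -> nilpotent A.
Proof.
move=> fI [n [H /cseries_of_central[H' csH]]]; exists n.
exact: central_of_cseries (cseries_preim fI csH).
Qed.

Lemma nilpotency_class_exists G :
  nilpotent G -> exists c, nilpotency_class G c.
Proof.
move=> [n [H csH]].
pose P m := `[< exists H : nat -> groupClosed G, central_series m H >].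
have exP : exists m, P m by exists n; apply/asboolP; exists H.
case: (ex_minnP exP) => c /asboolP Pc minc; exists c; split=> // m K csK.
by apply: minc; apply/asboolP; exists K.
Qed.

(** If [x ^+ k] commutes with [y], then [x ^ y] and [x] are roots of the same
element. *)
Lemma commute_roots (pi : nat_pred) E n (H : nat -> set E) (u v : E) q r :
  cseries [set: E] n H ->
  (forall (x : E) q, pi.-nat q -> x ^+ q = 1 -> x = 1) ->
  pi.-nat q -> pi.-nat r -> commute (u ^+ q) (v ^+ r) -> commute u v.
Proof.
move=> csH tf piq pir cuv.
have uniq (x y : E) k : pi.-nat k -> x ^+ k = y ^+ k -> x = y.
  move=> pik; apply: (root_unique (@subgrpT E) csH _ _ _ pik) => // z s _.
  exact: tf.
have step (x y : E) k : pi.-nat k -> commute (x ^+ k) y -> commute x y.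
  move=> pik cxy; apply/commgP/conjg_fixP/(uniq _ _ k) => //.
  by rewrite -conjXg; apply/conjg_fixP/commgP.
by apply: (step _ _ q) => //; apply/commute_sym/(step _ _ r)/commute_sym.
Qed.

(** The roots [T i] of the terms of a central series of [A] form a central
series of [G]. Indeed, if [T i] is normal then [G / T i] has no torsion, and
commutators of elements with powers in [HA i.+1] and in [A] are trivial there
because commutators of these powers are; normality of [T i.+1] follows. *)
Lemma cseries_dense (pi : nat_pred) A G (h : hom A G) n H c HA :
  cseries [set: G] n H ->
  (forall (x : G) q, pi.-nat q -> x ^+ q = 1 -> x = 1) ->
  (forall g : G, exists q a, pi.-nat q /\ g ^+ q = h a) ->
  cseries [set: A] c HA -> exists H', cseries [set: G] c H'.
Proof.
move=> csH tf dense [sA A0 Ac Ai AR].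
pose T i := roots pi setT (h @` HA i).
have shA i : subgrp (h @` HA i) by exact: subgrp_image.
have sT i : subgrp (T i) by apply: subgrp_roots csH _ _.
have T0 x : T 0 x -> x = 1.
  move=> [_ [q [piq [a /A0 -> xq]]]]; apply: (tf _ q) => //.
  by rewrite -xq gmulf1.
have AT i a : HA i a -> T i (h a).
  by move=> Aa; apply: sub_roots => //; exists a.
have TS i : T i `<=` T i.+1.
  move=> x [_ [q [piq [a Aa xq]]]].
  by split=> //; exists q; split=> //; exists a => //; apply: Ai.
have TR i : normalized (T i) -> forall x g, T i.+1 x -> T i [~ x, g].
  move=> nT x g [_ [q [piq [a Aa xq]]]].
  have [r [b [pir gr]]] := dense g.
  have [E [f [fS fT]]] := quotient_exists (sT i) nT.
  apply/fT; rewrite gmulfR; apply/eqP/commgP.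
  apply: (commute_roots (cseries_image fS csH) _ piq pir) => [y k pik|].
    have [y' <-] := fS y; rewrite -gmulfXn => /fT Ty; apply/fT/rootsK.
    by split=> //; exists k.
  rewrite -!gmulfXn -xq gr; apply/commgP/eqP; rewrite -!gmulfR.
  by apply/fT/AT/AR.
have nT i : normalized (T i).
  elim: i => [|i IHi] x g; first by move=> /T0->; rewrite conj1g; case: (sT 0).
  move=> Tx; rewrite -[x ^ g](mulKg x^-1) invgK -commgEl; apply: sgM => //.
  exact/TS/TR.
exists T; split=> //.
- move=> g _; have [q [a [piq gq]]] := dense g; split=> //.
  by exists q; split=> //; exists a => //; apply: Ac.
by move=> i x g _ _; apply: TR.
Qed.
End Nilpotent.

(** * The isolator in a residually bounded nilpotent group *)

Section Isolator.
Variables (C : group_class) (X : groupType) (Y : groupClosed X).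
Variables (Q : groupType) (sigma : hom X Q).
Hypotheses (rC : root_class C) (pC : forall G : groupType, C G -> periodic G).
Hypotheses (resX : residually (BN C) X) (bQ : BN C Q).
Hypothesis sigmaI : {in Y &, injective sigma}.
Local Notation P := (primes_of C).
Local Notation pi := (P^').
Local Notation Ys := ([set y | y \in Y]).
Local Notation I := (isolator pi Y).

Lemma BN_torsion (B : groupType) (x : B) q :
  BN C B -> pi.-nat q -> x ^+ q = 1 -> x = 1.
Proof.
move=> [tfB _] piq xq; apply/eqP; apply: (isolated_pnat tfB piq).
by rewrite xq inE.
Qed.

Lemma BN_root_unique (B : groupType) (x y : B) q :
  BN C B -> pi.-nat q -> x ^+ q = y ^+ q -> x = y.
Proof.
move=> bB piq.
have [n [H /cseries_of_central[H' csH]]] := nilpotent_of_bounded bB.2.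
apply: (root_unique (@subgrpT B) csH _ _ _ piq) => // z r _; exact: BN_torsion.
Qed.

Lemma eq_by_BN_homs x y :
  (forall (B : groupType) (f : hom X B), BN C B -> f x = f y) -> x = y.
Proof.
move=> fxy; apply: divg1_eq; apply: contrapT => /eqP xy1.
have [|B [f [bB _ fxy1]]] := resX (x := x / y); first by rewrite inE.
by apply: fxy1; exists 1; rewrite /= ?inE // gmulf1 gmulfF (fxy B f bB) mulgV.
Qed.

Lemma residual_root_unique (x y : X) q : pi.-nat q -> x ^+ q = y ^+ q -> x = y.
Proof.
move=> piq xyq; apply: eq_by_BN_homs => B f bB.
by apply: (BN_root_unique bB piq); rewrite -!gmulfXn xyq.
Qed.

Lemma pair_morph (B : groupType) (f : hom X B) :
  {morph (fun x => (sigma x, f x)) : x y / x * y}.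
Proof. by move=> x y; rewrite !gmulfM. Qed.

Definition pair_hom (B : groupType) (f : hom X B) : hom X (Q * B)%type :=
  mkhom (pair_morph f).

Lemma bounded_pair (B : groupType) : BN C B -> bounded_nilpotent C (Q * B)%type.
Proof.
move=> bB; apply: (bounded_nilpotent_joint (s := fst) (f := snd)).
- by move=> [a b] /= -> ->.
- exact: bQ.2.
- exact: bB.2.
Qed.

Lemma subgrp_image_roots (B : groupType) (f : hom X B) :
  bounded_nilpotent C B -> subgrp (roots pi setT (f @` Ys)).
Proof.
move=> /nilpotent_of_bounded[n [H /cseries_of_central[H' csH]]].
by apply: subgrp_roots csH _ _ => //; apply/subgrp_image/subgrp_carrier.
Qed.

(** Let [m] be the exponent and [w] in [Y] the element with
[(sigma x, f x) ^+ m = (sigma w, f w)]. Then [sigma] takes the same value at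
[z ^+ m] and [w ^+ n], so these are equal; hence [f (x ^+ n)] and [f z] have
the same power of exponent [m]. *)
Lemma pair_root (B : groupType) (f : hom X B) x n z :
  BN C B -> pi.-nat n -> z \in Y -> sigma (x ^+ n) = sigma z ->
  roots pi setT (pair_hom f @` Ys) (pair_hom f x) -> f (x ^+ n) = f z.
Proof.
move=> bB pin Yz sxn [_ [m [pim [w Yw e]]]].
have sw : sigma w = sigma x ^+ m.
  by have := congr1 fst e; rewrite (gmulfXn fst).
have fw : f w = f x ^+ m.
  by have := congr1 snd e; rewrite (gmulfXn snd).
have zw : z ^+ m = w ^+ n.
  apply: sigmaI; rewrite ?gpredXn // !gmulfXn -sxn sw gmulfXn.
  exact: expgnAC.
apply: (BN_root_unique bB pim).
by rewrite -[RHS]gmulfXn zw !gmulfXn fw expgnAC.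
Qed.

(** For roots [x] and [y], the image of [x / y] under [sigma] has a power
[sigma z], as roots form a subgroup of [Q]. All pairs [(sigma, f)] send [x / y]
to a root of the image of [Y], again because roots form a subgroup, so
[(x / y) ^+ n] and [z] have the same image under every [f]. *)
Lemma subgrp_root_set : subgrp [set x | x \in root_set pi Y].
Proof.
split=> [|x y /asboolP[q [piq Yx]] /asboolP[r [pir Yy]]].
  by apply/asboolP; exists 1%N; rewrite expg1n gpred1.
have rt (B : groupType) (f : hom X B) : bounded_nilpotent C B ->
    roots pi setT (f @` Ys) (f (x / y)).
  move=> bB; rewrite gmulfF; apply: (subgrp_image_roots f bB).2.
    by split=> //; exists q; split=> //; rewrite -gmulfXn; exists (x ^+ q).
  by split=> //; exists r; split=> //; rewrite -gmulfXn; exists (y ^+ r).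
have [_ [n [pin [z Yz sz]]]] := rt Q sigma bQ.2.
apply/asboolP; exists n; split=> //.
suff -> : (x / y) ^+ n = z by [].
apply: eq_by_BN_homs => B f bB; apply: pair_root => //.
  by rewrite gmulfXn.
exact/rt/bounded_pair.
Qed.

Lemma isolatorE : I =i root_set pi Y.
Proof.
move=> x; apply/idP/idP => [|/asboolP[q [piq Yx]]]; last first.
  apply: (isolated_pnat (@isolator_isolated pi X Y) piq).
  exact: sub_isolator Yx.
have RE y := grpE subgrp_root_set y.
move=> Ix; apply/RE; apply: isolator_min Ix => [y q q_pr qpi|y Yy].
  move=> /RE/asboolP[r [pir Yr]]; apply/RE/asboolP.
  exists (q * r)%N; rewrite pnatM pir pnatE // qpi.
  by rewrite expgnA.
by apply/RE/asboolP; exists 1%N.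
Qed.

Lemma isolator_rootP x :
  reflect (exists q, pi.-nat q /\ x ^+ q \in Y) (x \in I).
Proof. by rewrite isolatorE; apply: asboolP. Qed.

Lemma isolator_injective : {in I &, injective sigma}.
Proof.
move=> x y /isolator_rootP[q [piq Yx]] /isolator_rootP[r [pir Yy]] sxy.
have piqr : pi.-nat (q * r)%N by rewrite pnatM piq.
apply: (residual_root_unique piqr); apply: sigmaI.
- by rewrite expgnA gpredXn.
- by rewrite mulnC expgnA gpredXn.
by rewrite !gmulfXn sxy.
Qed.

Lemma isolator_hom_injective : injective (hcomp sigma (incl I)).
Proof.
move=> x y sxy; apply/val_inj/isolator_injective => //; exact: valP.
Qed.

Lemma residual_torsion_free : torsion_free pi X.
Proof.
move=> x q q_pr qpi; rewrite !inE => /eqP xq; apply/eqP.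
by apply: (@residual_root_unique _ _ q); [rewrite pnatE | rewrite xq expg1n].
Qed.

Lemma isolator_BN : BN C (subgroup_type I).
Proof.
split.
  move=> x q q_pr qpi; rewrite !inE => /eqP xq; apply/eqP/val_inj.
  have : val x \in trivial_subgroup X.
    apply: (residual_torsion_free q_pr qpi); rewrite inE.
    by apply/eqP; have := congr1 (incl I) xq; rewrite gmulfXn gmulf1.
  by rewrite inE => /eqP->; rewrite gmulf1.
pose f := hcomp sigma (incl I).
apply: (bounded_nilpotent_joint (s := f) (f := f)).
- by move=> x sx _; apply: isolator_hom_injective; rewrite sx gmulf1.
- exact: bQ.2.
- exact: bQ.2.
Qed.

(** Central series of the isolator restrict to [Y]; conversely every element of
the isolator has a power in [Y]. *)
Lemma isolator_class : exists c : nat,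
  nilpotency_class (subgroup_type Y) c /\ nilpotency_class (subgroup_type I) c.
Proof.
have YI (y : subgroup_type Y) : incl Y y \in I by apply/sub_isolator/valP.
have [h hE] := corestrict YI.
have hI : injective h.
  by move=> x y /(congr1 val); rewrite !hE => /val_inj.
have nI : nilpotent (subgroup_type I).
  exact: nilpotent_of_bounded isolator_BN.2.
have [n [H csH]] := nI; have [H' csH'] := cseries_of_central csH.
have [c [[K csK] minc]] := nilpotency_class_exists (nilpotent_injective hI nI).
have [K' csK'] := cseries_of_central csK.
exists c; split; split=> //; first by exists K.
  have tfI x q := @BN_torsion _ x q isolator_BN.
  have [|H1 csH1] := cseries_dense (h := h) csH' tfI _ csK'.
    move=> g; have /isolator_rootP[q [piq Yq]] := valP g.
    exists q, (Sub (val g ^+ q) Yq); split=> //.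
    by apply: val_inj; rewrite hE gmulfXn.
  exact: central_of_cseries csH1.
move=> m L /cseries_of_central[L' csL].
have [M csM] := central_of_cseries (cseries_preim hI csL).
exact: minc csM.
Qed.

(** Surjectivity is obtained by passing to the image, which stays in the
class. *)
Lemma separable_of_hom (S : groupClosed X) x (W : groupType) (g : hom X W) :
  nilpotent_class C W -> ~ (g @` [set y | y \in S]) (g x) ->
  exists (R : groupType) (f : hom X R),
    [/\ nilpotent_class C R, surjective f & ~ (f @` [set y | y \in S]) (f x)].
Proof.
move=> [nW CW] gx; pose B := grp (subgrp_image g (@subgrpT X)).
have gB y : g y \in B by apply/grpE; exists y.
have [f fE] := corestrict gB.
exists (subgroup_type B), f; split.
- split; last exact: root_subgroup CW.
  exact: (@nilpotent_injective _ _ (incl B) val_inj).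
- move=> b; have /grpE[y _ gy] := valP b; exists y; apply: val_inj.
  by rewrite fE gy.
by move=> [y Sy /(congr1 val)]; rewrite !fE => gxy; apply: gx; exists y.
Qed.

Lemma residually_nilpotent : residually (nilpotent_class C) X.
Proof.
move=> x x1; have [B [f [bB _ fx]]] := resX x1.
have fx1 : ~ [set 1] (f x).
  by move=> e; apply: fx; exists 1; rewrite /= ?inE // gmulf1 e.
have [|W [g [NW gx]]] := bounded_separable rC pC bB.2 (subgrp1 B) _ fx1.
  by move=> y q piq yq; exact: BN_torsion piq yq.
apply: (separable_of_hom (g := hcomp g f) NW).
move=> [y /= /eqP -> e]; apply: gx; exists 1 => //.
have {}e : g (f 1) = g (f x) := e.
by rewrite -e [f 1]gmulf1.
Qed.

(** If [sigma x] is not a root of the image of [Y], separate it in [Q].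
Otherwise [sigma (x ^+ n) = sigma z] with [x ^+ n] different from [z], and
some [f] tells these two apart; then [(sigma x, f x)] is not a root of the
image of [Y], and one separates in [Q * B]. *)
Lemma isolator_separable : separable (nilpotent_class C) I.
Proof.
move=> x xI.
have sep (B : groupType) (f : hom X B) : bounded_nilpotent C B ->
    ~ roots pi setT (f @` Ys) (f x) ->
    exists (R : groupType) (f : hom X R),
      [/\ nilpotent_class C R, surjective f & ~ (f @` [set y | y \in I]) (f x)].
  move=> bB fx.
  have [|W [g [NW gx]]] :=
    bounded_separable rC pC bB (subgrp_image_roots f bB) _ fx.
    by move=> y q piq rty; apply: rootsK; split=> //; exists q.
  apply: (separable_of_hom (g := hcomp g f) NW).
  move=> [y /isolator_rootP[q [piq Yq]] e]; apply: gx; exists (f y) => //.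
  by split=> //; exists q; split=> //; rewrite -gmulfXn; exists (y ^+ q).
have [[_ [n [pin [z Yz sz]]]]|no] :=
  pselect (roots pi setT (sigma @` Ys) (sigma x)).
  have [B [f [bB fxz]]] : exists (B : groupType) (f : hom X B),
      BN C B /\ f (x ^+ n) <> f z.
    apply: contrapT => no; move/negP: xI; apply; apply/isolator_rootP.
    exists n; split=> //; suff -> : x ^+ n = z by [].
    apply: eq_by_BN_homs => B f bB; apply: contrapT => fxz.
    by apply: no; exists B, f.
  apply: (sep _ (pair_hom f) (bounded_pair bB)) => rt.
  by apply: fxz; apply: pair_root => //; rewrite gmulfXn.
exact: sep bQ.2 no.
Qed.
End Isolator.

Theorem theorem2p4 (C : group_class) (X : groupType) (Y : groupClosed X)
    (Q : groupType) (sigma : hom X Q) :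
  root_class C ->
  (forall G : groupType, C G -> periodic G) ->
  residually (BN C) X ->
  BN C Q -> surjective sigma -> {in Y &, injective sigma} ->
  ([/\ separable (nilpotent_class C) (isolator (primes_of C)^' Y),
       isolator (primes_of C)^' Y =i root_set (primes_of C)^' Y,
       exists c : nat,
         nilpotency_class (subgroup_type Y) c /\
         nilpotency_class (subgroup_type (isolator (primes_of C)^' Y)) c,
       residually (nilpotent_class C) X &
       torsion_free (primes_of C)^' X]) /\
  ({in isolator (primes_of C)^' Y &, injective sigma} /\
   BN C (subgroup_type (isolator (primes_of C)^' Y))).
Proof.
move=> rC pC resX bQ _ sigmaI; split; [split|split].
- exact: isolator_separable bQ sigmaI.
- exact: isolatorE bQ sigmaI.
- exact: isolator_class bQ sigmaI.
- exact: residually_nilpotent.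
- exact: residual_torsion_free.
- exact: isolator_injective bQ sigmaI.
exact: isolator_BN bQ sigmaI.
Qed.
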